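(* Let $n>d\ge1$ and $m\ge1$ be integers, let $A\in\mathbb{R}^{n\times d}$ be a fixed matrix of rank $d$, and let $\mathcal{C}\subseteq\mathbb{R}^d$ be a convex set. Let $S\in\mathbb{R}^{m\times n}$ be a random matrix with i.i.d. Gaussian entries of mean $0$ and variance $1/m$. For $y\in\mathbb{R}^n$ write $x_{LS}(y)=\arg\min_{x\in\mathcal{C}}\|Ax-y\|_2^2$ whenever this minimizer exists (it is then unique), and for $\sigma\ge0$ let $Y_\sigma$ be the set of all $y\in\mathbb{R}^n$ for which $x_{LS}(y)$ exists and $y^\perp:=y-Ax_{LS}(y)$ satisfies $\|y^\perp\|_2=\sigma$. Suppose there exists $B>0$ such that $[-B,B]^d\subseteq\mathcal{C}$. Then for every measurable function $g:\mathbb{R}^{m\times d}\times\mathbb{R}^m\to\mathbb{R}^d$ and every $\sigma\ge 0$, the estimator $\widetilde{x}=g(SA,Sy)$ satisfies $$\sup_{y\in Y_\sigma}\mathbb{E}\left[\|A(\widetilde{x}-x_{LS}(y))\|_2^2\right]\ \ge\ \frac{d}{m}\,\sigma^2\left(1-\frac{\pi^2\sigma^2}{mB^2\,\sigma_{\min}(A^TA)}\right),$$ where $\sigma_{\min}(A^TA)$ is the minimum eigenvalue of $A^TA$. In particular, for unconstrained least squares ($\mathcal{C}=\mathbb{R}^d$), $$\sup_{y\in Y_\sigma}\mathbb{E}\left[\|A(\widetilde{x}-x_{LS}(y))\|_2^2\right]\ \ge\ \frac{d}{m}\,\sigma^2 .$$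
   Context: The matrix $A$ and vector $y$ are deterministic; the only randomness is in the sketching matrix $S$, and expectations are over $S$. An estimator obtained from the Gaussian sketched data is a measurable function of $(SA,Sy)$. The supremum may be $+\infty$. *)

(* Defs.v *)
From HB Require Import structures.
From mathcomp Require Import all_boot all_order all_algebra.
From mathcomp Require Import all_classical all_reals all_analysis.

Set Implicit Arguments.
Unset Strict Implicit.
Unset Printing Implicit Defensive.

Import Order.TTheory GRing.Theory Num.Theory.
Import numFieldNormedType.Exports.

Local Open Scope classical_set_scope.
Local Open Scope ring_scope.

(* The library norm on matrices is the sup norm, hence this definition. *)
Definition l2norm (R : realType) (n : nat) (v : 'cV[R]_n) : R :=
  Num.sqrt (\sum_(i < n) v i ord0 ^+ 2).

Definition least_squares (R : realType) (n d : nat) (A : 'M[R]_(n, d))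
    (C : set 'cV[R]_d) (y : 'cV[R]_n) : set 'cV[R]_d :=
  [set x | C x /\
     forall z, C z -> l2norm (A *m x - y) ^+ 2 <= l2norm (A *m z - y) ^+ 2].

(* Junk value 0 when there is no minimizer; when A has full column rank and C
   is convex there is at most one minimizer, so no choice is involved. *)
Definition x_LS (R : realType) (n d : nat) (A : 'M[R]_(n, d))
    (C : set 'cV[R]_d) (y : 'cV[R]_n) : 'cV[R]_d :=
  xget 0 (least_squares A C y).

Definition Y_ (R : realType) (n d : nat) (A : 'M[R]_(n, d))
    (C : set 'cV[R]_d) (sigma : R) : set 'cV[R]_n :=
  [set y | least_squares A C y !=set0 /\
     l2norm (y - A *m x_LS A C y) = sigma].

(* For a symmetric matrix of positive size the set of real eigenvalues is
   finite and nonempty, so this infimum is a minimum. *)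
Definition min_eigenvalue (R : realType) (d : nat) (M : 'M[R]_d) : R :=
  inf [set a | eigenvalue M a].

Definition mutually_independent (disp : measure_display)
    (Omega : measurableType disp) (R : realType) (P : probability Omega R)
    (I : finType) (X : I -> {RV P >-> R}) : Prop :=
  forall (J : {set I}) (U : I -> set R), (forall i, measurable (U i)) ->
    P (\bigcap_(i in [set` J]) X i @^-1` U i)
      = (\prod_(i in J) P (X i @^-1` U i))%E.

(* The second parameter of normal_prob is the standard deviation. *)
Definition iid_gaussian (disp : measure_display)
    (Omega : measurableType disp) (R : realType) (P : probability Omega R)
    (m n : nat) (S : 'I_m -> 'I_n -> {RV P >-> R}) (mean variance : R) : Prop :=
  mutually_independent (fun ij : 'I_m * 'I_n => S ij.1 ij.2) /\
  forall i j (U : set R), measurable U ->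
    distribution P (S i j) U = normal_prob mean (Num.sqrt variance) U.

Definition random_matrix (disp : measure_display)
    (Omega : measurableType disp) (R : realType) (P : probability Omega R)
    (m n : nat) (S : 'I_m -> 'I_n -> {RV P >-> R}) (w : Omega) : 'M[R]_(m, n) :=
  \matrix_(i, j) S i j w.

(* Measurability for the Borel sigma-algebras on both sides. *)
Definition measurable_estimator (R : realType) (m d : nat)
    (g : 'M[R]_(m, d) * 'cV[R]_m -> 'cV[R]_d) : Prop :=
  @measurable_fun _ _
    (g_sigma_algebraType (@open ('M[R]_(m, d) * 'cV[R]_m)%type))
    (g_sigma_algebraType (@open 'cV[R]_d)) [set: _] g.

(* Main.v *)
Require Import Defs.
From HB Require Import structures.
From mathcomp Require Import all_boot all_order all_algebra.
From mathcomp Require Import all_classical all_reals all_analysis.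
From mathcomp Require Import measurable_realfun ring lra.

Set Implicit Arguments.
Unset Strict Implicit.
Unset Printing Implicit Defensive.

Import Order.TTheory GRing.Theory Num.Theory.
Import numFieldNormedType.Exports.

Local Open Scope classical_set_scope.
Local Open Scope ring_scope.

(** The supremum over [Y_ A C sigma] dominates the average of the risk over any
prior carried by that set, and the average is bounded below by van Trees'
inequality, the Bayesian form of the Cramer-Rao bound.

Since [d < n] there is [y] orthogonal to the columns of [A] with norm [sigma].
For [x] in [C] the observation [A x + y] has least squares solution [x] and
residual [y], so it lies in [Y_ A C sigma], and its risk is the quadratic loss
incurred in estimating [x] itself. Let the coordinates of [x] be independent
with density [cos^2 (pi t / 2B) / B] on [-B, B]: this density has the least
Fisher information, [(pi / B)^2], among the laws on that interval, and the cube
lies in [C].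

Write [a_i] for the columns of [A], [G = A^T A], [c = sigma^2 / m], [e] for the
estimation error, and [tau] for the logarithmic derivative of the prior
density. Given [S A], the vector [S y] is Gaussian with covariance [c] times
the identity, so that the data form a Gaussian regression with design [S A],
and, up to the factor [c], the score of the joint law in the direction [x_i] is
[psi_i = <S a_i, S y> + c tau(x_i)] (see [score]). Completing a square gives
  [|A e|^2 >= 2 <e, psi> - <psi, G^-1 psi>]  ([loss_lower_bound]),
and the two averages on the right are
  [E (e_i psi_i) = c]  ([integral_err_score]),
  [E (psi_i psi_j) = c G_ij + (i = j) c^2 (pi / B)^2]  ([score_moment]).
So the Bayes risk is at least [c d - c^2 (pi / B)^2 tr G^-1], and each diagonal
entry of [G^-1] is at most the inverse of the least eigenvalue of [G]
([inv_gram_diag]). The bound for the unconstrained problem follows by letting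
[B] tend to infinity.

The identity [E (e_i psi_i) = c] is where the sketch enters. Instead of
conditioning on [S A], one uses that adding [t a_i] to the observation [A x + y]
amounts to replacing [S] by [S (1 + t a_i y^T / |y|^2)], a shear which leaves
[S A] unchanged, and under which the law of [S] acquires the density
[exp ((t <S a_i, S y> - t^2 |S a_i|^2 / 2) / c)] ([gaussian_rank1_change]).
After this change of variables the estimate no longer depends on [x_i], and an
integration by parts in that single variable ([prior_parts]) gives the
identity.

All facts about Gaussian matrices are reduced to integrals in one real variable
by resampling: redrawing one entry of a matrix with i.i.d. entries preserves its
law ([iid_law_resample]). *)

(** * Borel sets of a space of matrices *)

(** The Borel structure of the entrywise topology, as in [measurable_estimator]. *)
Notation borel_mx R a b := (g_sigma_algebraType (@open 'M[R]_(a, b))).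

Section borel_matrices.
Context {R : realType} {a b : nat}.

Lemma measurable_coord (i : 'I_a) (j : 'I_b) :
  measurable_fun [set: borel_mx R a b] (fun M : 'M[R]_(a, b) => M i j).
Proof.
apply: (measurability _ (measurable_realfun.RGenOInfty.measurableE R)).
move=> _ [_ [x ->] <-]; rewrite setTI; apply: sub_sigma_algebra.
apply: open_comp; last exact: interval_open.
by move=> M _; exact: coord_continuous.
Qed.

(** An open set of matrices is the union of the boxes with rational centre and
radius [1/(k+1)] that it contains, and there are countably many such boxes;
this reduces Borel measurability to that of the entries. *)
Lemma measurable_mxP d (T : measurableType d) (f : T -> 'M[R]_(a, b)) :
  (forall i j, measurable_fun setT (fun t => f t i j)) ->
  measurable_fun setT (f : T -> borel_mx R a b).
Proof.
move=> mf; apply: (@measurability _ _ T (borel_mx R a b) setT f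
  (@open 'M[R]_(a, b))) => //.
move=> _ [U oU <-]; rewrite setTI.
pose bx (Q : 'M[rat]_(a, b)) (k : nat) : set 'M[R]_(a, b) :=
  [set M | forall i j, `|ratr (Q i j) - M i j| < k.+1%:R^-1].
have -> : f @^-1` U = \bigcup_(p in [set p | bx p.1 p.2 `<=` U]) (f @^-1` (bx p.1 p.2)).
  rewrite eqEsubset; split; last by move=> t [p /= pU fp]; exact: pU.
  move=> t /= Ut.
  have : nbhs (f t) U by exact: open_nbhs_nbhs.
  move=> /nbhs_ballP[e /= e0 eU].
  have [k ke] : exists k : nat, (k.+1%:R^-1 : R) < e / 2.
    have e20 : 0 < e / 2 by rewrite divr_gt0.
    have := near_infty_natSinv_lt (PosNum e20).
    by move=> [k _ /(_ k (leqnn _))]; exists k.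
  have Qex i j : exists q : rat, `|ratr q - f t i j| < k.+1%:R^-1.
    have lt_fij : f t i j - k.+1%:R^-1 < f t i j + k.+1%:R^-1.
      by rewrite ltrD2l gtrN// invr_gt0.
    have [q] := rat_in_itvoo lt_fij.
    by rewrite in_itv/= => /andP[q1 q2]; exists q; rewrite ltr_distl q1 q2.
  exists (\matrix_(i, j) projT1 (cid (Qex i j)), k) => /=; last first.
    by move=> i j; rewrite mxE; case: cid.
  move=> M MQ; apply: eU; split=> [|i j] /=; first exact: e0.
  have := MQ i j; rewrite mxE; case: cid => q /= hq hM.
  rewrite /ball/=.
  apply: (le_lt_trans (ler_distD (ratr q) _ _)).
  rewrite (splitr e) ltrD ?(lt_trans _ ke)//.
  by rewrite distrC.
rewrite bigcup_mkcond; apply: countable_bigcupT_measurable => [|[Q k]].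
  exact: countableP.
case: ifPn => // _.
have -> : f @^-1` (bx (Q, k).1 (Q, k).2) =
    \bigcap_(i in setT) \bigcap_(j in setT)
      (fun t => f t i j) @^-1` [set x | `|ratr (Q i j) - x| < k.+1%:R^-1].
  by apply/seteqP; split => t /=; [move=> h i _ j _; exact: h|move=> h i j; exact: h].
apply: fin_bigcap_measurable => // i _; apply: fin_bigcap_measurable => // j _.
rewrite -[X in measurable X]setTI; apply: mf => //.
have -> : [set x : R | `|ratr (Q i j) - x| < k.+1%:R^-1] =
    `](ratr (Q i j) - k.+1%:R^-1), (ratr (Q i j) + k.+1%:R^-1)[%classic.
  by apply/seteqP; split => x /=; rewrite in_itv/= ltr_distlC.
exact: measurable_itv.
Qed.

Definition box (U : 'I_a -> 'I_b -> set R) : set 'M[R]_(a, b) :=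
  [set M | forall i j, U i j (M i j)].

Lemma measurable_box U : (forall i j, measurable (U i j)) ->
  measurable (box U : set (borel_mx R a b)).
Proof.
move=> mU.
have -> : box U = \bigcap_(i in setT) \bigcap_(j in setT)
    (fun M : 'M[R]_(a, b) => M i j) @^-1` U i j.
  by apply/seteqP; split => t /=; [move=> h i _ j _; exact: h|move=> h i j; exact: h].
apply: fin_bigcap_measurable => // i _; apply: fin_bigcap_measurable => // j _.
by rewrite -[X in measurable X]setTI; apply: measurable_coord.
Qed.

Lemma borel_mx_boxE :
  @measurable _ (borel_mx R a b) =
  <<s [set box U | U in [set U | forall i j, measurable (U i j)]] >>.
Proof.
set G := [set box U | U in _].
apply/seteqP; split; last first.
  apply: smallest_sub; first exact: smallest_sigma_algebra.
  by move=> _ [U mU <-]; exact: measurable_box.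
have mid : measurable_fun setT (id : g_sigma_algebraType G -> borel_mx R a b).
  apply: measurable_mxP => i j _ V mV; rewrite setTI.
  apply: sub_sigma_algebra.
  exists (fun i' j' => if (i' == i) && (j' == j) then V else setT).
    by move=> i' j'; case: ifP.
  apply/seteqP; split => M /=; first by move=> /(_ i j); rewrite !eqxx.
  by move=> VM i' j'; case: ifP => // /andP[/eqP -> /eqP ->].
by move=> A mA; have := mid measurableT A mA; rewrite setTI.
Qed.

(** Boxes are closed under intersection, so a finite measure is determined by its
values on them. *)
Lemma box_measure_unique (m1 m2 : {measure set (borel_mx R a b) -> \bar R}) :
  (m1 setT < +oo)%E ->
  (forall U, (forall i j, measurable (U i j)) -> m1 (box U) = m2 (box U)) ->
  forall A, measurable A -> m1 A = m2 A.
Proof.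
move=> m1fin m12 A mA.
apply: (measure_unique _ (fun=> setT) borel_mx_boxE) => //.
- move=> _ _ [U mU <-] [V mV <-]; exists (fun i j => U i j `&` V i j).
    by move=> i j; exact: measurableI.
  apply/seteqP; split => M /=; first by move=> h; split => i j; have [] := h i j.
  by move=> [h1 h2] i j; split; [exact: h1|exact: h2].
- by move=> _; exists (fun _ _ => setT) => //; apply/seteqP; split.
- by rewrite bigcup_const.
- by move=> _ [U mU <-]; exact: m12.
Qed.

End borel_matrices.

(** * Matrices with independent, identically distributed entries *)

Definition mfun_of d d' (X : measurableType d) (Y : measurableType d')
    (f : X -> Y) (mf : measurable_fun setT f) : {mfun X >-> Y} :=
  HB.pack f (isMeasurableFun.Build _ _ _ _ f mf).

Section product_laws.
Context {R : realType} {a b : nat}.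
Implicit Types (M : 'M[R]_(a, b)) (s : R).

Definition set_entry (i : 'I_a) (j : 'I_b) s M : 'M[R]_(a, b) :=
  \matrix_(k, l) if (k == i) && (l == j) then s else M k l.

Lemma set_entry_eq i j s M : set_entry i j s M i j = s.
Proof. by rewrite mxE !eqxx. Qed.

Lemma set_entryK i j s s' M :
  set_entry i j s (set_entry i j s' M) = set_entry i j s M.
Proof.
by apply/matrixP => k l; rewrite !mxE; case: ((k == i) && (l == j)).
Qed.

Lemma measurable_set_entry i j d (T : measurableType d)
    (f : T -> 'M[R]_(a, b)) (g : T -> R) :
  measurable_fun setT (f : T -> borel_mx R a b) -> measurable_fun setT g ->
  measurable_fun setT ((fun t => set_entry i j (g t) (f t)) : T -> borel_mx R a b).
Proof.
move=> mf mg; apply: measurable_mxP => k l.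
under eq_fun do rewrite mxE.
case: ((k == i) && (l == j)) => //; exact: (measurableT_comp (measurable_coord k l) mf).
Qed.

(** The product formula on boxes. It is stated for a bare set function so that it
applies at once to laws obtained from a product measure and from a random
matrix. *)
Definition iid_law (q : probability (measurableTypeR R) R)
    (nu : set (borel_mx R a b) -> \bar R) : Prop :=
  forall U : 'I_a -> 'I_b -> set R, (forall i j, measurable (U i j)) ->
  nu (box U) = (\prod_(ij : 'I_a * 'I_b) q (U ij.1 ij.2))%E.

Section resampling.
Variables (q : probability (measurableTypeR R) R)
  (nu : probability (borel_mx R a b) R) (i : 'I_a) (j : 'I_b).

Let mset : measurable_fun setT
  ((fun z => set_entry i j z.2 z.1) :
    borel_mx R a b * measurableTypeR R -> borel_mx R a b).
Proof. exact: measurable_set_entry measurable_fst measurable_snd. Qed.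

Definition resample : probability (borel_mx R a b) R :=
  distribution (nu \x q)%E (mfun_of mset).

Lemma resample_box U : (forall k l, measurable (U k l)) ->
  resample (box U) =
  (nu (box (fun k l => if (k == i) && (l == j) then setT else U k l)) *
   q (U i j))%E.
Proof.
move=> mU.
pose U' k l := if (k == i) && (l == j) then setT else U k l.
have mU' k l : measurable (U' k l) by rewrite /U'; case: ifP.
have E : mfun_of mset @^-1` box U = box U' `*` U i j.
  apply/seteqP; split => -[M s] /=.
    move=> h; split=> [k l|]; last by have := h i j; rewrite mxE !eqxx.
    by have := h k l; rewrite mxE /U'; case: ifP.
  move=> [h Us] k l; rewrite mxE; case: ifP => [/andP[/eqP-> /eqP->]//|kl].
  by have := h k l; rewrite /U' kl.
transitivity ((nu \x q)%E (box U' `*` U i j)); first by rewrite -E.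
by apply: product_measure1E; [exact: measurable_box|exact: mU].
Qed.

Lemma integral_resample (f : 'M[R]_(a, b) -> \bar R) :
  measurable_fun setT (f : borel_mx R a b -> \bar R) -> (forall M, 0 <= f M)%E ->
  (\int[resample]_M f M = \int[nu]_M \int[q]_s f (set_entry i j s M))%E.
Proof.
move=> mf f0.
rewrite ge0_integral_distribution//= fubini_tonelli1//=.
exact: measurableT_comp mf mset.
Qed.

End resampling.

(** Both sides integrate [f], against [nu] and against [resample], and these two
laws agree on boxes. This is the substitute for Fubini's theorem in the
[a * b] entries: it isolates one entry and never splits the space. *)
Lemma iid_law_resample q (nu : probability (borel_mx R a b) R) i j
    (f : 'M[R]_(a, b) -> \bar R) :
  iid_law q nu ->
  measurable_fun setT (f : borel_mx R a b -> \bar R) -> (forall M, 0 <= f M)%E ->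
  (\int[nu]_M f M = \int[nu]_M \int[q]_s f (set_entry i j s M))%E.
Proof.
move=> nuq mf f0; rewrite -integral_resample//.
apply: eq_measure_integral => A mA _.
apply: (@box_measure_unique _ _ _ nu (resample q nu i j)) => //.
  by rewrite -ge0_fin_numE ?fin_num_measure.
move=> U mU; apply: (etrans (nuq _ mU)).
apply: (etrans _ (esym (resample_box _ _ _ _ mU))).
rewrite nuq; last by move=> k l; case: ifP.
rewrite (bigD1 (i, j))//= [X in _ = (X * _)%E](bigD1 (i, j))//=.
rewrite !eqxx probability_setT mul1e muleC; congr (_ * _)%E.
by apply: eq_bigr => -[k l] /=; rewrite xpair_eqE => /negbTE ->.
Qed.

(** Start from the point mass at the zero matrix and redraw the entries one after
the other; after the entries in [s] have been redrawn, the law on boxes is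
[w s]. *)
Lemma iid_law_exists q :
  exists nu : probability (borel_mx R a b) R, iid_law q nu.
Proof.
pose w (s : seq ('I_a * 'I_b)) (U : 'I_a -> 'I_b -> set R) ij : \bar R :=
  if ij \in s then q (U ij.1 ij.2) else (\1_(U ij.1 ij.2) 0)%:E.
suff /(_ (enum {: 'I_a * 'I_b}) (enum_uniq _))[nu nuE] :
    forall s : seq ('I_a * 'I_b), uniq s ->
    exists nu : probability (borel_mx R a b) R,
    forall U, (forall i j, measurable (U i j)) ->
    nu (box U) = (\prod_ij w s U ij)%E.
  exists nu => U mU; rewrite nuE//; apply: eq_bigr => ij _.
  by rewrite /w mem_enum.
elim=> [_|[i j] s IHs /andP[ijs us]].
  exists (dirac (0 : borel_mx R a b)) => U mU; rewrite [LHS]diracE.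
  have [U0|/existsNP[i /existsNP[j U0]]] := pselect (forall i j, U i j 0).
    rewrite mem_set; last by move=> i j; rewrite mxE.
    by rewrite big1// => ij _; rewrite /w/= indicE mem_set.
  rewrite memNset; last by move=> /(_ i j); rewrite mxE.
  rewrite (bigD1 (i, j))//= {1}/w/= indicE memNset// mul0e//.
have [nu nuE] := IHs us; exists (resample q nu i j) => U mU.
rewrite (resample_box _ _ _ _ mU) nuE; last by move=> k l; case: ifP.
rewrite (bigD1 (i, j))//= [RHS](bigD1 (i, j))//= muleAC.
rewrite {1 3}/w/= (negbTE ijs) !eqxx/= indicT mul1e mem_head/=.
congr (_ * _)%E; apply: eq_bigr => -[k l] kl.
rewrite /w/= inE (negbTE kl)/=; move: kl; rewrite xpair_eqE => /negbTE ->//.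
Qed.

End product_laws.

(** * Densities and translations *)

Section density.
Local Open Scope ereal_scope.
Context d (T : measurableType d) (R : realType).
Variables (mu : {sigma_finite_measure set T -> \bar R})
  (nu : {finite_measure set T -> \bar R}) (h : T -> R).
Hypotheses (mh : measurable_fun setT h) (h0 : (forall x, 0 <= h x)%R).
Hypothesis nuE : forall V, measurable V -> nu V = \int[mu]_(x in V) (h x)%:E.

(** [h] is a Radon-Nikodym derivative of [nu], and such derivatives are unique up
to null sets. *)
Lemma ge0_integral_density (f : T -> \bar R) :
  measurable_fun setT f -> (forall x, 0 <= f x) ->
  \int[nu]_x f x = \int[mu]_x (f x * (h x)%:E).
Proof.
move=> mf f0.
have mhE : measurable_fun setT (EFin \o h) by exact/measurable_EFinP.
have ih : mu.-integrable setT (EFin \o h).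
  apply/integrableP; split => //.
  under eq_integral do rewrite /= ger0_norm//.
  by rewrite -nuE// ltey_eq fin_num_measure.
have numu : nu `<< mu.
  apply/null_content_dominatesP => V mV V0; rewrite nuE//.
  by apply: null_set_integral => //; exact: measurable_funTS.
rewrite -(Radon_Nikodym_SigmaFinite.change_of_variables numu)//.
have iRN := Radon_Nikodym_SigmaFinite.f_integrable numu.
apply: ae_eq_integral => //; [| |].
- by apply: emeasurable_funM => //; exact: measurable_int iRN.
- exact: emeasurable_funM.
apply: ae_eqe_mul2l; apply: integral_ae_eq => // V _ mV.
by rewrite -Radon_Nikodym_SigmaFinite.f_integral// nuE.
Qed.

End density.

Section translation.
Context {R : realType}.
Local Open Scope ereal_scope.
Notation mu := (@lebesgue_measure R).

Lemma ge0_integral_translation (f : R -> \bar R) (c : R) :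
  measurable_fun setT f -> (forall x, 0 <= f x) ->
  \int[mu]_x f (x + c)%R = \int[mu]_x f x.
Proof.
move=> mf f0.
have mc : measurable_fun setT ((fun x => (x + c)%R) : measurableTypeR R -> measurableTypeR R).
  exact: measurable_funD.
transitivity (\int[pushforward mu (mfun_of mc)]_x f x).
  by rewrite ge0_integral_pushforward.
apply: eq_measure_integral => A mA _.
apply/esym/lebesgue_measure_unique => //= _ [[a b]] _ <-.
rewrite /pushforward.
have -> : (fun x => (x + c)%R) @^-1` `]a, b] = `](a - c)%R, (b - c)%R]%classic.
  by apply/seteqP; split => x /=; rewrite !in_itv/= ltrBlDr lerBrDr.
rewrite !lebesgue_measure_itv/= !lte_fin ltrD2r -!EFinD.
by case: ifP => // _; congr EFin; ring.
Qed.

End translation.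

(** * Shears of a Gaussian matrix *)

Section gaussian_shear.
Context {R : realType} {a b : nat}.
Variables (v : R) (nu : probability (borel_mx R a b) R).
Hypothesis v0 : 0 < v.
Hypothesis nuN : iid_law (normal_prob 0 (Num.sqrt v)) nu.

(** The inverse of the density of a Gaussian matrix with entries of variance [v],
up to a constant. Multiplying by it turns the Gaussian law into a multiple of
Lebesgue measure on the space of matrices, which is invariant under shears. *)
Definition inv_density (M : 'M[R]_(a, b)) : R :=
  expR ((\sum_ij M ij.1 ij.2 ^+ 2) / (v *+ 2)).

Lemma measurable_inv_density :
  measurable_fun setT (inv_density : borel_mx R a b -> R).
Proof.
apply: measurableT_comp => //; apply: measurable_funM => //.
by apply: measurable_sum => ij; apply: measurable_funX; exact: measurable_coord.
Qed.

Lemma inv_density_ge0 M : 0 <= inv_density M. Proof. exact: expR_ge0. Qed.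

Let sv0 : Num.sqrt v != 0. Proof. by rewrite gt_eqF// sqrtr_gt0. Qed.

Lemma ge0_integral_normal_prob (f : R -> \bar R) :
  measurable_fun setT f -> (forall x, 0 <= f x)%E ->
  (\int[normal_prob 0 (Num.sqrt v)]_x f x =
   \int[lebesgue_measure]_x (f x * (normal_pdf 0 (Num.sqrt v) x)%:E))%E.
Proof.
move=> mf f0; apply: ge0_integral_density => //.
- exact: measurable_normal_pdf.
- exact: normal_pdf_ge0.
Qed.

Lemma inv_density_normal_pdf i j s M :
  inv_density (set_entry i j s M) * normal_pdf 0 (Num.sqrt v) s =
  normal_peak (Num.sqrt v) * inv_density (set_entry i j 0 M).
Proof.
rewrite normal_pdfE// /inv_density /normal_fun mulrCA -expRD; congr (_ * expR _).
rewrite (bigD1 (i, j))//= [in RHS](bigD1 (i, j))//= !mxE !eqxx/=.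
rewrite expr0n/= add0r subr0 sqr_sqrtr ?ltW// mulrDl -addrA addrCA.
rewrite mulNr addrN addr0; congr (_ / _); apply: eq_bigr => -[k l] /=.
by rewrite xpair_eqE !mxE => /negbTE ->.
Qed.

(** For fixed other entries, [h] is a constant and the weighted integral is one
against Lebesgue measure in the entry [(i, j)], hence invariant under
translation. *)
Lemma entry_shear (i : 'I_a) (j : 'I_b) (h : 'M[R]_(a, b) -> R)
    (F : 'M[R]_(a, b) -> \bar R) :
  measurable_fun setT (h : borel_mx R a b -> R) ->
  (forall s M, h (set_entry i j s M) = h M) ->
  measurable_fun setT (F : borel_mx R a b -> \bar R) -> (forall M, 0 <= F M)%E ->
  (\int[nu]_M (F (set_entry i j (M i j + h M) M) * (inv_density M)%:E) =
   \int[nu]_M (F M * (inv_density M)%:E))%E.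
Proof.
move=> mh hM mF F0.
have mset M : measurable_fun setT (F \o (set_entry i j ^~ M)).
  apply: (@measurableT_comp _ _ _ _ _ _ (F : borel_mx R a b -> \bar R)) => //.
  exact: measurable_set_entry.
have mW : measurable_fun setT (fun M : borel_mx R a b => (inv_density M)%:E).
  by apply/measurable_EFinP; exact: measurable_inv_density.
rewrite (iid_law_resample i j nuN); last 2 first.
- apply: emeasurable_funM => //.
  apply: (@measurableT_comp _ _ _ _ _ _ (F : borel_mx R a b -> \bar R)) => //.
  apply: measurable_set_entry => //; apply: measurable_funD => //.
  exact: measurable_coord.
- by move=> M; rewrite mule_ge0// lee_fin inv_density_ge0.
rewrite [RHS](iid_law_resample i j nuN); last 2 first.
- exact: emeasurable_funM.
- by move=> M; rewrite mule_ge0// lee_fin inv_density_ge0.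
apply: eq_integral => M _.
have mWs : measurable_fun setT (fun s => (inv_density (set_entry i j s M))%:E).
  apply/measurable_EFinP.
  apply: (@measurableT_comp _ _ _ _ _ _ (inv_density : borel_mx R a b -> R)) => //.
    exact: measurable_inv_density.
  exact: measurable_set_entry.
have mFs : measurable_fun setT (fun s : R => F (set_entry i j (s + h M) M)).
  by apply: (measurableT_comp (mset M)) => //; exact: measurable_funD.
rewrite ge0_integral_normal_prob; last 2 first.
- under eq_fun do rewrite set_entryK set_entry_eq hM.
  exact: emeasurable_funM.
- by move=> s; rewrite mule_ge0// lee_fin inv_density_ge0.
rewrite [RHS]ge0_integral_normal_prob; last 2 first.
- by apply: emeasurable_funM => //; exact: mset.
- by move=> s; rewrite mule_ge0// lee_fin inv_density_ge0.
under eq_integral do rewrite set_entryK set_entry_eq hM -muleA -EFinM inv_density_normal_pdf.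
under [RHS]eq_integral do rewrite -muleA -EFinM inv_density_normal_pdf.
pose G (s : R) := (F (set_entry i j s M) *
  (normal_peak (Num.sqrt v) * inv_density (set_entry i j 0 M))%:E)%E.
apply: (@ge0_integral_translation R G (h M)).
- by apply: emeasurable_funM => //; exact: mset.
- move=> s; rewrite mule_ge0// lee_fin mulr_ge0 ?inv_density_ge0//.
  exact: normal_peak_ge0.
Qed.

(** Since [H] does not depend on the entries in [J], the shear [M + H M] is the
composition of shears of the single entries in [J]. *)
Lemma block_shear (J : pred ('I_a * 'I_b)) (H : 'M[R]_(a, b) -> 'M[R]_(a, b))
    (F : 'M[R]_(a, b) -> \bar R) :
  measurable_fun setT (H : borel_mx R a b -> borel_mx R a b) ->
  (forall M i j, ~~ J (i, j) -> H M i j = 0) ->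
  (forall M (D : 'M[R]_(a, b)), (forall i j, ~~ J (i, j) -> D i j = 0) -> H (M + D) = H M) ->
  measurable_fun setT (F : borel_mx R a b -> \bar R) -> (forall M, 0 <= F M)%E ->
  (\int[nu]_M (F ((M : 'M[R]_(a, b)) + H M)%R * (inv_density M)%:E) =
   \int[nu]_M (F M * (inv_density M)%:E))%E.
Proof.
move=> mH HJ HD mF F0.
pose Hs (s : seq ('I_a * 'I_b)) M : 'M[R]_(a, b) :=
  \matrix_(i, j) if (i, j) \in s then H M i j else 0.
have mHij i j : measurable_fun setT (fun M : borel_mx R a b => H M i j).
  exact: measurableT_comp (measurable_coord i j) mH.
have HsE (M : 'M[R]_(a, b)) : M + H M = M + Hs [seq ij <- enum {: 'I_a * 'I_b} | J ij] M.
  congr (_ + _); apply/matrixP => i j; rewrite mxE mem_filter mem_enum andbT.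
  by case: ifPn => // /HJ.
under eq_integral do rewrite HsE.
have : uniq [seq ij <- enum {: 'I_a * 'I_b} | J ij].
  by rewrite filter_uniq// enum_uniq.
have : all J [seq ij <- enum {: 'I_a * 'I_b} | J ij] by exact: filter_all.
move: [seq ij <- enum {: 'I_a * 'I_b} | J ij] => s0.
elim: s0 F mF F0 => [|[i j] s IHs] F mF F0 /=.
  move=> _ _; apply: eq_integral => M _; congr (F _ * _)%E.
  by apply/matrixP => k l; rewrite !mxE addr0.
move=> /andP[Jij Js] /andP[ijs us].
pose T (M : 'M[R]_(a, b)) := set_entry i j (M i j + H M i j) M.
have Hset s' (M : 'M[R]_(a, b)) : H (set_entry i j s' M) = H M.
  rewrite -(HD M (set_entry i j s' M - M)) 1?addrC ?subrK// => k l kl.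
  rewrite !mxE; case: ifP => [/andP[/eqP kE /eqP lE]|_]; last by rewrite ?subrr ?addNr.
  by move: kl; rewrite kE lE Jij.
(* H does not see the entries already moved, so the steps compose. *)
have TE (M : 'M[R]_(a, b)) : M + Hs ((i, j) :: s) M = T (M + Hs s M).
  apply/matrixP => k l; rewrite /T HD; last first.
    move=> k' l'; rewrite mxE; case: ifP => // /(allP Js) -> //.
  rewrite !mxE inE xpair_eqE.
  have [/andP[/eqP-> /eqP->]|kl] := boolP ((k == i) && (l == j)) => //=.
  by rewrite (negbTE ijs) addr0.
under eq_integral do rewrite TE.
rewrite (IHs (F \o T))//.
- apply: (entry_shear (h := fun M => H M i j)) => //.
  by move=> s' M; rewrite Hset.
- apply: (@measurableT_comp _ _ _ _ _ _ (F : borel_mx R a b -> \bar R)) => //.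
  apply: measurable_set_entry => //; apply: measurable_funD => //.
  exact: measurable_coord.
- by move=> M /=.
Qed.

End gaussian_shear.

(** * Inner products and rank-one changes of variables *)

Definition dot (R : realType) (n : nat) (x y : 'cV[R]_n) : R :=
  \sum_i x i ord0 * y i ord0.

Section dot_theory.
Context {R : realType} {n : nat}.
Implicit Types (x y z : 'cV[R]_n) (k : R).

Lemma dotE x y : dot x y = (x^T *m y) ord0 ord0.
Proof. by rewrite mxE; apply: eq_bigr => i _; rewrite mxE. Qed.

Lemma dotC x y : dot x y = dot y x.
Proof. by apply: eq_bigr => i _; rewrite mulrC. Qed.

Lemma dotDl x y z : dot (x + y) z = dot x z + dot y z.
Proof. by rewrite -big_split/=; apply: eq_bigr => i _; rewrite mxE mulrDl. Qed.

Lemma dotZl k x y : dot (k *: x) y = k * dot x y.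
Proof. by rewrite mulr_sumr; apply: eq_bigr => i _; rewrite mxE mulrA. Qed.

Lemma dotDr x y z : dot x (y + z) = dot x y + dot x z.
Proof. by rewrite dotC dotDl !(dotC x). Qed.

Lemma dotZr k x y : dot x (k *: y) = k * dot x y.
Proof. by rewrite dotC dotZl dotC. Qed.

Lemma dotNl x y : dot (- x) y = - dot x y.
Proof. by rewrite -scaleN1r dotZl mulN1r. Qed.

Lemma dotNr x y : dot x (- y) = - dot x y.
Proof. by rewrite dotC dotNl dotC. Qed.

Lemma dot0l x : dot 0 x = 0.
Proof. by rewrite /dot big1// => i _; rewrite mxE mul0r. Qed.

Lemma dot0r x : dot x 0 = 0.
Proof. by rewrite dotC dot0l. Qed.

Lemma dot_deltal x i : dot (delta_mx i ord0) x = x i ord0.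
Proof.
rewrite /dot (bigD1 i)//= big1 ?addr0 ?mxE ?eqxx ?mul1r// => k ki.
by rewrite mxE (negbTE ki) mul0r.
Qed.

Lemma dotxx_ge0 x : 0 <= dot x x.
Proof. by apply: sumr_ge0 => i _; rewrite -expr2 sqr_ge0. Qed.

Lemma dotxx_eq0 x : dot x x = 0 -> x = 0.
Proof.
move=> /eqP; rewrite psumr_eq0 => [/allP h|i _]; last by rewrite -expr2 sqr_ge0.
apply/colP => i; rewrite mxE; apply/eqP.
by have := h i (mem_index_enum _); rewrite mulf_eq0 orbb.
Qed.

End dot_theory.

Lemma dot_mulmxl (R : realType) n p (A : 'M[R]_(n, p)) (x : 'cV[R]_p) (y : 'cV[R]_n) :
  dot (A *m x) y = dot x (A^T *m y).
Proof. by rewrite !dotE trmx_mul mulmxA. Qed.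

Lemma outerE (R : realType) n p (x : 'cV[R]_p) (y : 'cV[R]_n) k l :
  (x *m y^T) k l = x k ord0 * y l ord0.
Proof. by rewrite mxE big_ord1 mxE. Qed.

Lemma mulmx_rank1 (R : realType) n p q (x : 'cV[R]_p) (y z : 'cV[R]_n)
    (t : 'cV[R]_q) :
  (x *m y^T) *m (z *m t^T) = dot y z *: (x *m t^T).
Proof.
rewrite mulmxA -(mulmxA x) (_ : y^T *m z = (dot y z)%:M).
  by rewrite mul_mx_scalar -scalemxAl.
by rewrite [LHS]mx11_scalar dotE.
Qed.

Section measurable_products.
Context {R : realType} d (T : measurableType d).

Lemma measurable_mulmx p q r (f : T -> 'M[R]_(p, q)) (g : T -> 'M[R]_(q, r)) :
  measurable_fun setT (f : T -> borel_mx R p q) ->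
  measurable_fun setT (g : T -> borel_mx R q r) ->
  measurable_fun setT ((fun t => f t *m g t) : T -> borel_mx R p r).
Proof.
move=> mf mg; apply: measurable_mxP => i j.
under eq_fun do rewrite mxE.
apply: measurable_sum => k; apply: measurable_funM.
  exact: measurableT_comp (measurable_coord i k) mf.
exact: measurableT_comp (measurable_coord k j) mg.
Qed.

Lemma measurable_addmx p q (f g : T -> 'M[R]_(p, q)) :
  measurable_fun setT (f : T -> borel_mx R p q) ->
  measurable_fun setT (g : T -> borel_mx R p q) ->
  measurable_fun setT ((fun t => f t + g t) : T -> borel_mx R p q).
Proof.
move=> mf mg; apply: measurable_mxP => i j.
under eq_fun do rewrite mxE.
apply: measurable_funD.
  exact: measurableT_comp (measurable_coord i j) mf.
exact: measurableT_comp (measurable_coord i j) mg.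
Qed.

Lemma measurable_dot p (f g : T -> 'cV[R]_p) :
  measurable_fun setT (f : T -> borel_mx R p 1) ->
  measurable_fun setT (g : T -> borel_mx R p 1) ->
  measurable_fun setT (fun t => dot (f t) (g t)).
Proof.
move=> mf mg; apply: measurable_sum => k; apply: measurable_funM.
  exact: measurableT_comp (measurable_coord k ord0) mf.
exact: measurableT_comp (measurable_coord k ord0) mg.
Qed.

End measurable_products.

Section linear_shears.
Context {R : realType} {m n : nat}.
Variables (v : R) (nu : probability (borel_mx R m n) R).
Hypothesis v0 : 0 < v.
Hypothesis nuN : iid_law (normal_prob 0 (Num.sqrt v)) nu.
Local Notation w := (@inv_density R m n v).

Lemma column_shear (c : pred 'I_n) (C : 'M[R]_n) (F : 'M[R]_(m, n) -> \bar R) :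
  (forall k l, ~~ c l -> C k l = 0) -> (forall k l, c k -> C k l = 0) ->
  measurable_fun setT (F : borel_mx R m n -> \bar R) -> (forall M, 0 <= F M)%E ->
  (\int[nu]_M (F ((M : 'M[R]_(m, n)) *m (1%:M + C))%R * (w M)%:E) =
   \int[nu]_M (F M * (w M)%:E))%E.
Proof.
move=> Cl Ck mF F0.
under eq_integral do rewrite mulmxDr mulmx1.
apply: (block_shear v0 nuN (J := fun ij => c ij.2) (H := fun M => M *m C)) => //.
- by apply: measurable_mulmx => //; exact: measurable_cst.
- by move=> M i j /= cj; rewrite mxE big1// => k _; rewrite (Cl _ _ cj) mulr0.
- move=> M D D0; rewrite mulmxDl [X in _ + X](_ : _ = 0) ?addr0//.
  apply/matrixP => i j; rewrite !mxE big1// => k _.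
  by have [ck|ck] := boolP (c k); [rewrite Ck// mulr0|rewrite D0// mul0r].
Qed.

(** The map [1 + a u^T] with [u] orthogonal to [a] is a shear, but not along
coordinate axes. With [p] such that [u_p] is nonzero, a conjugation by the
shear [1 + e_p y^T] turns it into one that only changes column [p], so that it
is a product of three column shears. *)
Lemma rank1_shear (a u : 'cV[R]_n) (F : 'M[R]_(m, n) -> \bar R) :
  dot u a = 0 ->
  measurable_fun setT (F : borel_mx R m n -> \bar R) -> (forall M, 0 <= F M)%E ->
  (\int[nu]_M (F ((M : 'M[R]_(m, n)) *m (1%:M + a *m u^T))%R * (w M)%:E) =
   \int[nu]_M (F M * (w M)%:E))%E.
Proof.
move=> ua mF F0.
have [->|/cV0Pn[p up]] := eqVneq u 0.
  by under eq_integral do rewrite trmx0 mulmx0 addr0 mulmx1.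
(* Normalize u to e + y with y_p = 0; then a u^T is conjugate to u_p b e^T. *)
pose e : 'cV[R]_n := delta_mx p ord0.
pose y : 'cV[R]_n := (u p ord0)^-1 *: u - e.
pose b : 'cV[R]_n := a + dot y a *: e.
have yp : y p ord0 = 0 by rewrite !mxE !eqxx/= mulVf// subrr.
have ek k : k != p -> e k ord0 = 0 by move=> kp; rewrite mxE (negbTE kp).
have ep : e p ord0 = 1 by rewrite mxE !eqxx.
have de x : dot e x = x p ord0 by exact: dot_deltal.
have uE : u = u p ord0 *: (e + y).
  by rewrite /y addrCA subrr addr0 scalerA mulfV// scale1r.
have ya : dot y a = - a p ord0.
  by rewrite /y dotDl dotZl ua mulr0 add0r dotNl de.
have bp : b p ord0 = 0 by rewrite !mxE eqxx ya mulr1 subrr.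
have ye : dot y e = 0 by rewrite dotC de.
have factor : 1%:M + a *m u^T =
    (1%:M - e *m y^T) *m (1%:M + u p ord0 *: (b *m e^T)) *m (1%:M + e *m y^T).
  have yb : dot y b = dot y a by rewrite /b dotDr dotZr ye mulr0 addr0.
  have aE : a = b - dot y a *: e by rewrite /b addrK.
  have ee : dot e e = 1 by rewrite de ep.
  have uT : u^T = u p ord0 *: (e^T + y^T) by rewrite {1}uE linearZ linearD.
  rewrite uT {1}aE.
  rewrite !(mulmxDl, mulmxDr, mulNmx, mulmxN, mul1mx, mulmx1).
  rewrite -?scalemxAr -?scalemxAl !(mulmxDl, mulmxDr, mulNmx, mulmxN).
  rewrite -?scalemxAr -?scalemxAl ?mulmx_rank1 ?yb.
  rewrite -?scalemxAr -?scalemxAl ?mulmx_rank1 ?yb ?ye ?ee.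
  move: (e *m y^T) (a *m e^T) (a *m y^T) (e *m e^T) => E1 E2 E3 E4.
  by apply/matrixP => k l; rewrite !mxE; ring.
have mFC (G : 'M[R]_(m, n) -> \bar R) C :
    measurable_fun setT (G : borel_mx R m n -> \bar R) ->
    measurable_fun setT ((fun M => G (M *m C)) : borel_mx R m n -> \bar R).
  move=> mG.
  apply: (@measurableT_comp _ _ _ _ _ _ (G : borel_mx R m n -> \bar R)) => //.
  by apply: measurable_mulmx => //; exact: measurable_cst.
under eq_integral do rewrite factor !mulmxA.
pose F2 M := F (M *m (1%:M + e *m y^T)).
pose F1 M := F2 (M *m (1%:M + u p ord0 *: (b *m e^T))).
rewrite (@column_shear (predC1 p) (- (e *m y^T)) F1)//.
- rewrite (@column_shear (pred1 p) (u p ord0 *: (b *m e^T)) F2)//.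
  + apply: (@column_shear (predC1 p) (e *m y^T) F) => //=.
    * by move=> k l; rewrite negbK => /eqP ->; rewrite outerE yp mulr0.
    * by move=> k l kp; rewrite outerE ek// mul0r.
  + by move=> k l /= lp; rewrite mxE outerE ek// !mulr0.
  + by move=> k l /= /eqP ->; rewrite mxE outerE bp mul0r mulr0.
  + exact: mFC.
  + by move=> M; exact: F0.
- by move=> k l /=; rewrite negbK => /eqP ->; rewrite mxE outerE yp mulr0 oppr0.
- by move=> k l /= kp; rewrite mxE outerE ek// mul0r oppr0.
- exact: mFC (mFC _ _ mF).
- by move=> M; exact: F0.
Qed.

(** The density is the likelihood ratio of the law of [M (1 + a u^T)] with respect
to that of [M]: a shear preserves Lebesgue measure, so only the exponents
[-|M|^2 / 2v] have to be compared, and [(1 + a u^T)^-1 = 1 - a u^T]. *)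
Lemma gaussian_rank1_change (a u : 'cV[R]_n) (F : 'M[R]_(m, n) -> \bar R) :
  dot u a = 0 ->
  measurable_fun setT (F : borel_mx R m n -> \bar R) -> (forall M, 0 <= F M)%E ->
  (\int[nu]_M F ((M : 'M[R]_(m, n)) *m (1%:M + a *m u^T))%R =
   \int[nu]_M (F M * (expR ((dot (M *m a) (M *m u) -
     dot (M *m a) (M *m a) * dot u u / 2) / v))%:E))%E.
Proof.
move=> ua mF F0.
have w0 M : 0 < w M by exact: expR_gt0.
(* Dividing by the weight of the preimage of M cancels the weight that the
   invariance of rank1_shear introduces. *)
pose G M := (F M * ((w (M *m (1%:M - a *m u^T)))^-1)%:E)%E.
transitivity (\int[nu]_M (G ((M : 'M[R]_(m, n)) *m (1%:M + a *m u^T))%R * (w M)%:E))%E.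
  apply: eq_integral => M _; rewrite /G -mulmxA.
  rewrite (_ : (_ + _) *m _ = 1%:M).
    by rewrite mulmx1 -muleA -EFinM mulVf ?gt_eqF// mule1.
  rewrite mulmxDl mul1mx mulmxBr mulmx1 mulmx_rank1 ua scale0r subr0.
  by rewrite subrK.
rewrite rank1_shear//.
- apply: eq_integral => M _; rewrite /G -muleA -EFinM; congr (_ * EFin _)%E.
  rewrite /inv_density -expRN -expRD; congr expR.
  rewrite -mulNr -mulrDl mulr2n.
  transitivity ((2 * (dot (M *m a) (M *m u) -
    dot (M *m a) (M *m a) * dot u u / 2)) / (v + v)); last first.
    by rewrite -[v + v]mulr2n -(mulr_natl v) -mulf_div divff// mul1r.
  congr (_ / _).
  rewrite -sumrN -big_split/=.
  have cE i j : (M *m (1%:M - a *m u^T)) i j = M i j - (M *m a) i ord0 * u j ord0.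
    by rewrite mulmxBr mulmx1 mulmxA mxE; congr (_ + _); rewrite mxE outerE.
  under eq_bigr => ij _ do rewrite cE.
    rewrite -(pair_bigA _ (fun i j =>
    - (M i j - (M *m a) i ord0 * u j ord0) ^+ 2 + M i j ^+ 2))/=.
  rewrite mulrBr mulrCA mulfV// mulr1 [X in 2 * X]/dot mulr_sumr.
  rewrite [X in X * dot u u]/dot mulr_suml -sumrB; apply: eq_bigr => i _.
  move: (M *m a) => z; rewrite mxE /dot.
  rewrite !mulr_sumr -sumrB; apply: eq_bigr => j _; ring.
- apply: emeasurable_funM => //; apply/measurable_EFinP.
  have E M : (w (M *m (1%:M - a *m u^T)))^-1 =
             expR (- ln (w (M *m (1%:M - a *m u^T)))).
    by rewrite expRN lnK// posrE.
  under eq_fun do rewrite E.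
  apply: (measurableT_comp (@measurable_expR R)).
  apply: (measurableT_comp (@oppr_measurable R setT)).
  apply: (measurableT_comp (@measurable_ln R)).
  apply: (@measurableT_comp _ _ _ _ _ _ (w : borel_mx R m n -> R)).
    exact: measurable_inv_density.
  by apply: measurable_mulmx => //; exact: measurable_cst.
- by move=> M; rewrite mule_ge0// lee_fin invr_ge0 ltW.
Qed.

End linear_shears.

(** * The squared-cosine prior *)

Section calculus.
Context {R : realType}.
Notation mu := (@lebesgue_measure R).
Implicit Types (f g F G : R -> R) (a b : R).

Lemma is_derive_continuous F f : (forall x : R, is_derive x 1 F (f x)) -> continuous F.
Proof.
by move=> dF x; apply: differentiable_continuous; apply/derivable1_diffP; case: (dF x).
Qed.

Lemma is_derive_LRcontinuous F f a b : (forall x : R, is_derive x 1 F (f x)) ->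
  derivable_oo_LRcontinuous F a b.
Proof.
move=> dF; have cF := is_derive_continuous dF; split.
- by move=> x _; case: (dF x).
- exact: cvg_at_right_filter (cF a).
- exact: cvg_at_left_filter (cF b).
Qed.

Lemma integral_is_derive F f a b : a < b ->
  (forall x : R, is_derive x 1 F (f x)) -> continuous f ->
  (\int[mu]_(x in `[a, b]) (f x)%:E = (F b - F a)%:E)%E.
Proof.
move=> ab dF cf; rewrite (@continuous_FTC2 _ f F)//.
- exact: continuous_subspaceT.
- exact: is_derive_LRcontinuous dF.
- by move=> x _; rewrite derive1E; case: (dF x).
Qed.

Lemma integral_parts F G f g a b : a < b ->
  (forall x : R, is_derive x 1 F (f x)) -> continuous f ->
  (forall x : R, is_derive x 1 G (g x)) -> continuous g ->
  (\int[mu]_(x in `[a, b]) (F x * g x)%:E = (F b * G b - F a * G a)%:E -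
   \int[mu]_(x in `[a, b]) (f x * G x)%:E)%E.
Proof.
move=> ab dF cf dG cg; apply: integration_by_parts => //.
- exact: continuous_subspaceT.
- exact: is_derive_LRcontinuous dF.
- by move=> x _; rewrite derive1E; case: (dF x).
- exact: continuous_subspaceT.
- exact: is_derive_LRcontinuous dG.
- by move=> x _; rewrite derive1E; case: (dG x).
Qed.

(** Inversion is discontinuous at [0]; [x exp (- ln x^2)] is equal to it
everywhere, since the inverse of [0] is [0]. *)
Lemma measurable_invr : measurable_fun setT (fun x : R => x^-1).
Proof.
have -> : (fun x : R => x^-1) = (fun x => x * expR (- ln (x ^+ 2))).
  apply/funext => x; have [->|x0] := eqVneq x 0; first by rewrite invr0 mul0r.
  rewrite expRN lnK; last by rewrite posrE exprn_even_gt0.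
  by rewrite expr2 invfM mulrA mulfV// mul1r.
apply: measurable_funM => //.
apply: (measurableT_comp (@measurable_expR R)).
apply: (measurableT_comp (@oppr_measurable R setT)).
apply: (measurableT_comp (@measurable_ln R)).
exact: measurable_funX.
Qed.

End calculus.

Section density_probability.
Context {R : realType}.
Variable h : R -> R.
Hypotheses (mh : measurable_fun setT h) (h0 : forall x, 0 <= h x).
Hypothesis h1 : (\int[lebesgue_measure]_x (h x)%:E = 1)%E.

Lemma density_probability : exists q : probability (measurableTypeR R) R,
  forall V, measurable V -> q V = (\int[lebesgue_measure]_(x in V) (h x)%:E)%E.
Proof.
pose p := fun V : set (measurableTypeR R) => (\int[lebesgue_measure]_(x in V) (h x)%:E)%E.
have p0 : p set0 = 0%E by rewrite /p integral_set0.
have pge0 A : (0 <= p A)%E.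
  by rewrite /p integral_ge0//= => x _; rewrite lee_fin.
have pI : lebesgue_measure.-integrable setT (EFin \o h).
  apply/integrableP; split; first exact/measurable_EFinP.
  under eq_integral do rewrite /= ger0_norm//.
  by rewrite h1 ltry.
have psa : semi_sigma_additive p.
  move=> /= A mA tA mUA; rewrite /p/= integral_bigcup//=; last first.
    exact: (integrableS _ _ (subsetT _)).
  apply: is_cvg_ereal_nneg_natsum_cond => n _ _.
  by apply: integral_ge0 => /= x ?; rewrite lee_fin.
pose M := isMeasure.Build _ _ _ p p0 pge0 psa.
pose pm : {measure set (measurableTypeR R) -> \bar R} := HB.pack p M.
have pT : pm [set: _] = 1%E by [].
pose Pr := @Measure_isProbability.Build _ _ R pm pT.
pose pp : probability (measurableTypeR R) R := HB.pack p M Pr.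
by exists pp.
Qed.

End density_probability.

Lemma funeposMr (T : Type) (R : realType) (f h : T -> R) x : 0 <= h x ->
  ((fun x => (f x * h x)%:E)^\+ x = (fun x => (f x)%:E)^\+ x * (h x)%:E)%E.
Proof.
by move=> h0; rewrite !funeposE -!EFin_max -EFinM maxr_pMl// mul0r.
Qed.

Lemma funenegMr (T : Type) (R : realType) (f h : T -> R) x : 0 <= h x ->
  ((fun x => (f x * h x)%:E)^\- x = (fun x => (f x)%:E)^\- x * (h x)%:E)%E.
Proof.
by move=> h0; rewrite !funenegE -!EFinN -!EFin_max -EFinM maxr_pMl// mul0r mulNr.
Qed.

Section signed_density.
Local Open Scope ereal_scope.
Context d (T : measurableType d) (R : realType).
Variables (mu : {sigma_finite_measure set T -> \bar R})
  (nu : {finite_measure set T -> \bar R}) (h : T -> R).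
Hypotheses (mh : measurable_fun setT h) (h0 : (forall x, 0 <= h x)%R).
Hypothesis nuE : forall V, measurable V -> nu V = \int[mu]_(x in V) (h x)%:E.

Lemma integral_density (f : T -> R) : measurable_fun setT f ->
  \int[nu]_x (f x)%:E = \int[mu]_x (f x * h x)%:E.
Proof.
move=> mf; rewrite integralE [RHS]integralE; congr (_ - _).
- rewrite (ge0_integral_density mh h0 nuE)//; last first.
    by apply: measurable_funepos; exact/measurable_EFinP.
  by apply: eq_integral => x _; rewrite funeposMr.
- rewrite (ge0_integral_density mh h0 nuE)//; last first.
    by apply: measurable_funeneg; exact/measurable_EFinP.
  by apply: eq_integral => x _; rewrite funenegMr.
Qed.

End signed_density.

Section prior.
Context {R : realType}.
Variable B : R.
Hypothesis B0 : 0 < B.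
Notation mu := (@lebesgue_measure R).

Let theta := pi / (B *+ 2).

(** The analytic expression of the prior density. It vanishes at both ends of
[-B, B] but is smooth on the whole line, so that calculus can be done with it
rather than with its truncation [prior_pdf]. *)
Definition prior_wave (t : R) : R := cos (theta * t) ^+ 2 / B.

Definition prior_pdf (t : R) : R :=
  if t \in `]- B, B[ then prior_wave t else 0.

(** The logarithmic derivative of [prior_wave]. *)
Definition prior_score (t : R) : R :=
  - (pi / B) * (sin (theta * t) * (cos (theta * t))^-1).

Let thetaB : theta * B = pi / 2.
Proof. by rewrite /theta mulrC; field; rewrite gt_eqF. Qed.

Let theta0 : theta != 0.
Proof. by rewrite gt_eqF// divr_gt0 ?pi_gt0// pmulrn_lgt0. Qed.

Let is_derive_lin (x : R) : is_derive x 1 (fun t => theta * t) theta.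
Proof.
rewrite (_ : (fun t => theta * t) = theta *: (@id R)) //.
by apply: is_derive_eq; rewrite /GRing.scale/= mulr1.
Qed.

Let is_derive_cost (x : R) :
  is_derive x 1 (fun t => cos (theta * t)) (- sin (theta * x) * theta).
Proof. exact: (@is_derive1_comp R cos (fun t => theta * t)). Qed.

Let is_derive_sint (x : R) :
  is_derive x 1 (fun t => sin (theta * t)) (cos (theta * x) * theta).
Proof. exact: (@is_derive1_comp R sin (fun t => theta * t)). Qed.

Let ccost : continuous (fun t => cos (theta * t)).
Proof. exact: is_derive_continuous is_derive_cost. Qed.
Let csint : continuous (fun t => sin (theta * t)).
Proof. exact: is_derive_continuous is_derive_sint. Qed.

Let wave' (t : R) := - (pi / B ^+ 2) * (cos (theta * t) * sin (theta * t)).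

Lemma is_derive_prior_wave (t : R) : is_derive t 1 prior_wave (wave' t).
Proof.
rewrite (_ : prior_wave = B^-1 *: ((fun t => cos (theta * t)) ^+ 2)).
  apply: is_derive_eq; rewrite /GRing.scale/= /wave'.
  by rewrite /theta; field; rewrite gt_eqF.
by apply/funext => x /=; rewrite /prior_wave mulrC.
Qed.

Let cwave' : continuous wave'.
Proof.
move=> t; apply: cvgM; first exact: cvg_cst.
by apply: cvgM; [exact: ccost|exact: csint].
Qed.

Lemma continuous_prior_wave : continuous prior_wave.
Proof. exact: is_derive_continuous is_derive_prior_wave. Qed.

Lemma measurable_prior_wave : measurable_fun setT prior_wave.
Proof. exact: continuous_measurable_fun continuous_prior_wave. Qed.

Lemma prior_waveB : prior_wave B = 0.
Proof. by rewrite /prior_wave thetaB cos_pihalf expr0n mul0r. Qed.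

Lemma prior_waveNB : prior_wave (- B) = 0.
Proof. by rewrite /prior_wave mulrN cosN -/(prior_wave B) prior_waveB. Qed.

Lemma prior_wave_ge0 t : 0 <= prior_wave t.
Proof. by rewrite divr_ge0 ?sqr_ge0// ltW. Qed.

Lemma prior_pdf_ge0 t : 0 <= prior_pdf t.
Proof. by rewrite /prior_pdf; case: ifP => // _; exact: prior_wave_ge0. Qed.

Lemma measurable_prior_pdf : measurable_fun setT prior_pdf.
Proof.
rewrite (_ : prior_pdf = fun t => \1_(`]- B, B[%classic) t * prior_wave t).
  apply: measurable_funM; first exact: measurable_indic.
  exact: continuous_measurable_fun continuous_prior_wave.
apply/funext => t; rewrite /prior_pdf indicE mem_setE.
by case: ifP; rewrite ?mul1r ?mul0r.
Qed.

Lemma measurable_prior_score : measurable_fun setT prior_score.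
Proof.
apply: measurable_funM; first exact: measurable_cst.
apply: measurable_funM; first exact: continuous_measurable_fun csint.
apply: (measurableT_comp measurable_invr).
exact: continuous_measurable_fun ccost.
Qed.

Let NBB : - B < B. Proof. by rewrite gtrN. Qed.

Let costheta_gt0 t : t \in `]- B, B[ -> 0 < cos (theta * t).
Proof.
rewrite in_itv/= => /andP[tB Bt]; apply: cos_gt0_pihalf.
have th0 : 0 < theta by rewrite divr_gt0 ?pi_gt0// pmulrn_lgt0.
by rewrite -thetaB -mulrN !ltr_pM2l// tB.
Qed.

Lemma prior_scoreE t : t \in `]- B, B[ -> prior_score t * prior_wave t = wave' t.
Proof.
move=> /costheta_gt0 c0; rewrite /prior_score /prior_wave /wave'.
by field; rewrite !gt_eqF.
Qed.

Lemma integral_prior_pdf (f g : R -> R) : measurable_fun setT g ->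
  (forall t, t \in `]- B, B[ -> f t * prior_wave t = g t) ->
  (\int[mu]_t (f t * prior_pdf t)%:E = \int[mu]_(t in `[(- B)%R, B%R]) (g t)%:E)%E.
Proof.
move=> mg fg; rewrite integral_itv_bndoo; last first.
  by apply/measurable_EFinP; exact: measurable_funTS.
rewrite [RHS]integral_mkcond; apply: eq_integral => t _.
rewrite patchE /prior_pdf mem_setE.
by case: ifPn => [/fg ->//|_]; rewrite mulr0.
Qed.

(** The primitive comes from [cos^2 = (1 + cos (2 .)) / 2]. *)
Lemma integral_prior_wave : (\int[mu]_(t in `[(- B)%R, B%R]) (prior_wave t)%:E = 1)%E.
Proof.
pose F := (B * 2)^-1 *: (id \+ theta^-1 *:
  ((fun t => cos (theta * t)) * (fun t => sin (theta * t)))).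
have dF (t : R) : is_derive t 1 F (prior_wave t).
  apply: is_derive_eq; rewrite /GRing.scale/= /prior_wave.
  rewrite (_ : theta^-1 * _ = cos (theta * t) ^+ 2 - sin (theta * t) ^+ 2).
    by rewrite sin2cos2; field; rewrite gt_eqF.
  by field.
rewrite (integral_is_derive NBB dF continuous_prior_wave).
rewrite /F !fctE/= /GRing.scale/= !mulrN cosN thetaB cos_pihalf !(mul0r, mulr0, addr0).
by congr EFin; field; rewrite gt_eqF.
Qed.

Lemma integral_sin2_wave :
  (\int[mu]_(t in `[(- B)%R, B%R]) (sin (theta * t) ^+ 2 / B)%:E = 1)%E.
Proof.
have E t : sin (theta * t) ^+ 2 / B = B^-1 - prior_wave t.
  by rewrite sin2cos2 mulrBl mul1r.
under eq_integral do rewrite E EFinB.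
rewrite integralB//=.
- rewrite integral_prior_wave integral_cst//= lebesgue_measure_itv/= lte_fin NBB.
  by rewrite /= -EFinD; congr EFin; field; rewrite gt_eqF.
- by apply: continuous_compact_integrable; [exact: segment_compact|
    exact/continuous_subspaceT/cst_continuous].
- by apply: continuous_compact_integrable; [exact: segment_compact|
    exact/continuous_subspaceT/continuous_prior_wave].
Qed.

Definition prior_law (q : probability (measurableTypeR R) R) : Prop :=
  forall V, measurable V -> q V = (\int[mu]_(t in V) (prior_pdf t)%:E)%E.

Lemma prior_exists : exists q, prior_law q.
Proof.
apply: density_probability; [exact: measurable_prior_pdf|exact: prior_pdf_ge0|].
transitivity (\int[mu]_t (1 * prior_pdf t)%:E)%E.
  by apply: eq_integral => t _; rewrite mul1r.
rewrite (@integral_prior_pdf _ prior_wave) ?integral_prior_wave//.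
  exact: measurable_prior_wave.
by move=> t _; rewrite mul1r.
Qed.

Section prior_moments.
Variable q : probability (measurableTypeR R) R.
Hypothesis qE : prior_law q.

Lemma integral_prior (f g : R -> R) : measurable_fun setT f ->
  measurable_fun setT g ->
  (forall t, t \in `]- B, B[ -> f t * prior_wave t = g t) ->
  (\int[q]_t (f t)%:E = \int[mu]_(t in `[(- B)%R, B%R]) (g t)%:E)%E.
Proof.
move=> mf mg fg.
rewrite (@integral_density _ (measurableTypeR R) R mu q _
  measurable_prior_pdf prior_pdf_ge0 qE)//.
exact: integral_prior_pdf.
Qed.

Lemma prior_support : q `]- B, B[%classic = 1%E.
Proof.
rewrite qE//= -integral_prior_wave [RHS]integral_itv_bndoo; last first.
  by apply/measurable_EFinP; apply: measurable_funTS; exact: measurable_prior_wave.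
by apply: eq_integral => t; rewrite inE/= => tB; rewrite /prior_pdf tB.
Qed.

(** The score times the density is the derivative of the density, which vanishes at
both ends. *)
Lemma integral_prior_score : (\int[q]_t (prior_score t)%:E = 0)%E.
Proof.
rewrite (@integral_prior _ wave'); last exact: prior_scoreE.
- rewrite (integral_is_derive NBB is_derive_prior_wave cwave').
  by rewrite prior_waveB prior_waveNB subrr.
- exact: measurable_prior_score.
- exact: continuous_measurable_fun cwave'.
Qed.

(** The Fisher information of the prior. The square of the score times the density
is [(pi / B)^2 sin^2 (pi t / 2B) / B], and the sine has the same mean square as
the cosine. *)
Lemma integral_prior_score2 :
  (\int[q]_t (prior_score t ^+ 2)%:E = ((pi / B) ^+ 2)%:E)%E.
Proof.
have mg : measurable_fun setT (fun t => sin (theta * t) ^+ 2 / B).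
  apply: measurable_funM => //; apply: measurable_funX.
  exact: continuous_measurable_fun csint.
rewrite (@integral_prior _ (fun t => (pi / B) ^+ 2 * (sin (theta * t) ^+ 2 / B))).
- under eq_integral do rewrite EFinM.
  rewrite ge0_integralZl ?integral_sin2_wave ?mule1//.
  + by apply/measurable_EFinP; exact: measurable_funTS.
  + by move=> t _; rewrite lee_fin divr_ge0 ?sqr_ge0// ltW.
  + by rewrite lee_fin sqr_ge0.
- by apply: measurable_funX; exact: measurable_prior_score.
- by apply: measurable_funM => //; exact: measurable_cst.
- move=> t /costheta_gt0 c0; rewrite /prior_score /prior_wave.
  by field; rewrite !gt_eqF.
Qed.

(** Integration by parts: the factor of [g - t], times the density, is [c] times
the derivative of the product of the exponential and the density, and this
product vanishes at both ends. The variable [g] stands for an estimate that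
does not depend on [t]. *)
Lemma prior_parts (c z e g : R) : 0 < c ->
  (\int[q]_t ((g - t) * ((e - t * z + c * prior_score t) *
     expR ((t * e - t ^+ 2 * z / 2) / c)))%:E =
   c%:E * \int[q]_t (expR ((t * e - t ^+ 2 * z / 2) / c))%:E)%E.
Proof.
move=> c_gt0; have c0 : c != 0 by rewrite gt_eqF.
(* L is the likelihood ratio, and u is c times L times the prior density. *)
pose L (t : R) := expR ((t * e - t ^+ 2 * z / 2) / c).
pose L' (t : R) := (e - t * z) / c * L t.
have dL (t : R) : is_derive t 1 L (L' t).
  have -> : L = expR \o (c^-1 *: (e *: id - (z / 2) *: ((id : R -> R) ^+ 2))).
    by apply/funext => s; rewrite /L !fctE /=; congr expR; rewrite /GRing.scale/=; field.
  apply: is_derive_eq; rewrite /GRing.scale/= /L' /L.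
  rewrite mulrC; congr (_ * expR _); first by field.
  by rewrite !fctE /= /GRing.scale/=; field.
have cL : continuous L := is_derive_continuous dL.
have cL' : continuous L'.
  move=> t; apply: cvgM; last exact: cL.
  apply: cvgM; last exact: cvg_cst.
  by apply: cvgB; [exact: cvg_cst|apply: cvgM; [exact: cvg_id|exact: cvg_cst]].
pose u (t : R) := c * (L t * prior_wave t).
pose u' (t : R) := c * (L t * wave' t + prior_wave t * L' t).
have du (t : R) : is_derive t 1 u (u' t).
  have dw := is_derive_prior_wave t.
  have -> : u = c *: (L * prior_wave) by [].
  by apply: is_derive_eq.
have cu' : continuous u'.
  move=> t; apply: cvgM; first exact: cvg_cst.
  apply: cvgD; apply: cvgM.
  - exact: cL.
  - exact: cwave'.
  - exact: continuous_prior_wave.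
  - exact: cL'.
have dg (t : R) : is_derive t 1 (fun t : R => g - t) (- 1).
  have -> : (fun t : R => g - t) = cst g - id by [].
  by apply: is_derive_eq; rewrite sub0r.
have mL := continuous_measurable_fun cL.
have mLw : measurable_fun setT (fun t => L t * prior_wave t).
  by apply: measurable_funM => //; exact: measurable_prior_wave.
have -> : (\int[q]_t (expR ((t * e - t ^+ 2 * z / 2) / c))%:E =
           \int[mu]_(t in `[(- B)%R, B%R]) (L t * prior_wave t)%:E)%E.
  exact: (@integral_prior L).
rewrite (@integral_prior _ (fun t => (g - t) * u' t)).
- rewrite (integral_parts NBB dg (@cst_continuous _ _ _) du cu').
  rewrite /u prior_waveB prior_waveNB !mulr0 subrr sub0e.
  rewrite -ge0_integralZl//.
  + rewrite -[RHS]oppeK -integral_ge0N; last first.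
      move=> t _; rewrite -EFinM lee_fin; apply: mulr_ge0; first exact: ltW.
      by apply: mulr_ge0; [exact: expR_ge0|exact: prior_wave_ge0].
    by congr (- _)%E; apply: eq_integral => t _; congr EFin; ring.
  + by apply/measurable_EFinP; apply: measurable_funTS.
  + by move=> t _; rewrite lee_fin mulr_ge0 ?prior_wave_ge0// expR_ge0.
  + by rewrite lee_fin ltW.
- apply: measurable_funM; first exact: measurable_funB.
  apply: measurable_funM => //; apply: measurable_funD.
    by apply: measurable_funB => //; exact: measurable_funM.
  by apply: measurable_funM => //; exact: measurable_prior_score.
- apply: measurable_funM; first exact: measurable_funB.
  exact: continuous_measurable_fun cu'.
- move=> t tB; rewrite -/(L t) /u' -prior_scoreE// /L'; field => //.
Qed.

End prior_moments.

End prior.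

(** * Stein's identity for the normal law *)

Section stein.
Context {R : realType}.
Notation mu := (@lebesgue_measure R).

(** The integral over [-k, k] is a difference of two values of [G] that both tend
to [0]. *)
Lemma integral_derive_vanishing (G g : R -> R) :
  (forall x : R, is_derive x 1 G (g x)) -> continuous g ->
  mu.-integrable setT (EFin \o g) ->
  (G k%:R @[k --> \oo] --> 0) -> (G (- k%:R) @[k --> \oo] --> 0) ->
  (\int[mu]_x (g x)%:E = 0)%E.
Proof.
move=> dG cg ig Gy GNy.
have mg := continuous_measurable_fun cg.
pose I k := `[- k%:R, k%:R]%classic : set R.
pose f_ (k : nat) (x : R) := ((EFin \o g) \_ (I k)) x.
have f_E k : (0 < k)%N -> (\int[mu]_x f_ k x = (G k%:R - G (- k%:R))%:E)%E.
  move=> k0; rewrite -integral_mkcond (integral_is_derive _ dG cg)//.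
  by rewrite gtrN// ltr0n.
have : ([sequence (\int[mu]_x f_ n x)%E]_n @ \oo --> (\int[mu]_x (EFin \o g) x)%E).
  have [|||||//] := @dominated_convergence _ (measurableTypeR R) R mu setT
    measurableT f_ (EFin \o g) (abse \o (EFin \o g)).
  - move=> k; apply/(measurable_restrictT _ _).1 => //=.
      exact: measurable_itv.
    by apply: measurable_funTS; exact/measurable_EFinP.
  - exact/measurable_EFinP.
  - apply: aeW => x _; apply: cvg_near_cst.
    near=> k; rewrite /f_ patchE ifT// inE /I/= in_itv/= -ler_norml.
    near: k; exact: nbhs_infty_ger.
  - exact: integrable_abse.
  - apply: aeW => x k _; rewrite /f_ patchE; case: ifP => // _.
    by rewrite abse0 abse_ge0.
move=> h; apply/esym; apply: (cvg_unique _ _ h) => //.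
apply: cvg_trans (_ : (G k%:R - G (- k%:R))%:E @[k --> \oo] --> 0%E).
  apply: near_eq_cvg; near=> k; rewrite /= f_E//; near: k; exact: nbhs_infty_gt.
apply: cvg_EFin; first by apply: nearW.
rewrite -[X in _ --> X](subrr (0 : R)); exact: cvgB.
Unshelve. all: by end_near. Qed.

Variable v : R.
Hypothesis v0 : 0 < v.
Let s := Num.sqrt v.
Let s0 : s != 0. Proof. by rewrite gt_eqF// sqrtr_gt0. Qed.
Local Notation phi := (normal_pdf 0 s).

Let phiE x : phi x = normal_peak s * expR (- (x ^+ 2 / (v *+ 2))).
Proof.
by rewrite normal_pdfE// /normal_fun subr0 sqr_sqrtr ?ltW// mulNr.
Qed.

(* phi' is the normal density of twice the variance, which dominates p phi for
   every polynomial p. *)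
Let s' := Num.sqrt (v *+ 2).
Let s'0 : s' != 0. Proof. by rewrite gt_eqF// sqrtr_gt0 pmulrn_lgt0. Qed.
Local Notation phi' := (normal_pdf 0 s').

Let phi'E x : phi' x = normal_peak s' * expR (- (x ^+ 2 / (v *+ 4))).
Proof.
rewrite normal_pdfE// /normal_fun subr0 sqr_sqrtr ?mulrn_wge0 ?ltW// mulNr.
by rewrite -mulrnA.
Qed.

Let poly_bound (p : {poly R}) : exists C : R, forall x,
  `|p.[x]| <= C * expR (x ^+ 2 / (v *+ 4)).
Proof.
pose K i : R := 1 + (v *+ 4) ^+ i * i`!%:R.
have v40 : 0 < v *+ 4 by rewrite pmulrn_lgt0.
have Kb i x : `|x| ^+ i <= K i * expR (x ^+ 2 / (v *+ 4)).
  have y0 : 0 <= x ^+ 2 / (v *+ 4) by rewrite divr_ge0 ?sqr_ge0// ltW.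
  have y1 : 1 <= expR (x ^+ 2 / (v *+ 4)) by rewrite -expR0 ler_expR.
  have yi : (x ^+ 2) ^+ i <= (v *+ 4) ^+ i * i`!%:R * expR (x ^+ 2 / (v *+ 4)).
    rewrite -[X in X ^+ i](@divfK _ (v *+ 4)) ?gt_eqF// exprMn mulrC -mulrA.
    rewrite ler_pM2l ?exprn_gt0//.
    case: i => [|i]; first by rewrite expr0 fact0 mul1r.
    rewrite -ler_pdivrMl ?ltr0n ?fact_gt0// mulrC.
    by apply: le_trans (expR_ge1Dxn i y0); rewrite lerDr.
  rewrite mulrDl mul1r; have [x1|x1] := leP `|x| 1.
    rewrite (le_trans (exprn_ile1 _ _ _))// (le_trans y1)// lerDl.
    by rewrite mulr_ge0 ?expR_ge0// mulr_ge0// exprn_ge0// ltW.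
  apply: (@le_trans _ _ ((x ^+ 2) ^+ i)).
    rewrite -real_normK ?num_real// -exprM ler_weXn2l ?ltW// leq_pmull//.
  by rewrite (le_trans yi)// lerDr expR_ge0.
exists (\sum_(i < size p) `|p`_i| * K i) => x.
rewrite horner_coef mulr_suml (le_trans (ler_norm_sum _ _ _))//.
apply: ler_sum => i _; rewrite normrM normrX -mulrA ler_wpM2l//.
Qed.

Let poly_phi_bound (p : {poly R}) : exists C : R, forall x,
  `|p.[x] * phi x| <= C * phi' x.
Proof.
have [C Cp] := poly_bound p.
exists (C * normal_peak s / normal_peak s') => x.
have ps' : 0 < normal_peak s' by exact: normal_peak_gt0.
rewrite normrM (ger0_norm (normal_pdf_ge0 _ _ _)) phiE phi'E.
rewrite [leRHS]mulrA divfK ?gt_eqF//.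
apply: (le_trans (ler_wpM2r _ (Cp x))).
  by rewrite mulr_ge0 ?normal_peak_ge0 ?expR_ge0.
rewrite (_ : - (x ^+ 2 / (v *+ 4)) = x ^+ 2 / (v *+ 4) - x ^+ 2 / (v *+ 2)).
  by rewrite expRD le_eqVlt; apply/orP; left; apply/eqP; ring.
by field; rewrite gt_eqF.
Qed.

Let measurable_poly (p : {poly R}) : measurable_fun setT (fun x => p.[x]).
Proof. exact: continuous_measurable_fun (@continuous_horner R p). Qed.

Let poly_phi_integrable (p : {poly R}) :
  mu.-integrable setT (fun x => (p.[x] * phi x)%:E).
Proof.
have [C Cp] := poly_phi_bound p.
apply: (le_integrable measurableT _ _
  (integrableZl measurableT C (integrable_normal_pdf 0 s'))) => //.
  apply/measurable_EFinP; apply: measurable_funM; first exact: measurable_poly.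
  exact: measurable_normal_pdf.
by move=> x _; rewrite -EFinM /= lee_fin (le_trans (Cp x))// ler_norm.
Qed.

(** A polynomial is dominated by the exponential of [x^2 / 4v], so its product with
the normal density is dominated by a normal density of variance [2v]; the
latter is integrable. *)
Lemma normal_poly_integrable (p : {poly R}) :
  (normal_prob 0 s).-integrable setT (fun x => (p.[x])%:E).
Proof.
apply/integrableP; split.
  by apply/measurable_EFinP; exact: measurable_poly.
rewrite ge0_integral_normal_prob//; last first.
  apply: (measurableT_comp (@abse_measurable R setT)).
  by apply/measurable_EFinP; exact: measurable_poly.
have /integrableP[_] := poly_phi_integrable p.
congr (_ < _)%E; apply: eq_integral => x _.
by rewrite EFinM abseM [X in (_ * X)%E = _]gee0_abs ?lee_fin ?normal_pdf_ge0.
Qed.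

Let is_derive_phi (x : R) : is_derive x 1 phi (- (x / v) * phi x).
Proof.
have -> : phi = normal_peak s *: (expR \o (- (v *+ 2)^-1 *: ((id : R -> R) ^+ 2))).
  apply/funext => y; rewrite phiE !fctE /= /GRing.scale/=; congr (_ * expR _).
  by rewrite mulNr mulrC.
apply: is_derive_eq; rewrite !fctE /= /GRing.scale/=.
by field; rewrite gt_eqF.
Qed.

Let phi_poly_vanish (p : {poly R}) (e : R) : e ^+ 2 = 1 ->
  (p.[e * k%:R] * phi (e * k%:R)) @[k --> \oo] --> 0.
Proof.
move=> e2; have [C Cp] := poly_phi_bound p.
pose z := expR (- (v *+ 4)^-1).
have v40 : 0 < v *+ 4 by rewrite pmulrn_lgt0.
have C0 : 0 <= C * normal_peak s'.
  have := Cp 0; rewrite phi'E expr0n/= mul0r oppr0 expR0 mulr1.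
  by apply: le_trans; rewrite normr_ge0.
apply/norm_cvg0P.
apply: (@squeeze_cvgr _ _ _ _ (cst 0) (fun k => C * normal_peak s' * z ^+ k)).
- apply: nearW => k /=; rewrite normr_ge0/= (le_trans (Cp _))// phi'E mulrA.
  rewrite ler_wpM2l// /z -expRM_natl ler_expR exprMn e2 mul1r mulrN lerN2.
  rewrite ler_wpM2r ?invr_ge0 ?(ltW v40)// -natrX ler_nat.
  by case: k => // k; rewrite leq_pmulr.
- exact: cvg_cst.
- rewrite -[X in _ --> X](mulr0 (C * normal_peak s')).
  apply: cvgMr; apply: cvg_expr.
  by rewrite ger0_norm ?expR_ge0// expR_lt1 oppr_lt0 invr_gt0.
Qed.

Let integral_normal_probE (f : R -> R) : measurable_fun setT f ->
  (\int[normal_prob 0 s]_x (f x)%:E = \int[mu]_x (f x * phi x)%:E)%E.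
Proof.
move=> mf; apply: (@integral_density _ (measurableTypeR R) R mu (normal_prob 0 s)) => //.
- exact: measurable_normal_pdf.
- exact: normal_pdf_ge0.
Qed.

(** The function [(v p' - x p) phi] is the derivative of [v p phi], where [phi] is
the normal density, and [p phi] vanishes at infinity. *)
Lemma normal_stein (p : {poly R}) :
  (\int[normal_prob 0 s]_x (p.[x] * x)%:E =
   \int[normal_prob 0 s]_x (v * p^`().[x])%:E)%E.
Proof.
pose q := v *: p^`() - p * 'X.
have q0 : (\int[normal_prob 0 s]_x (q.[x])%:E = 0)%E.
  rewrite integral_normal_probE//.
  pose G x := v * (p.[x] * phi x).
  apply: (@integral_derive_vanishing G).
  - move=> x.
    have -> : G = v *: ((horner p) * phi) by [].
    have dphi := is_derive_phi x.
    apply: is_derive_eq; rewrite /q !hornerE /GRing.scale/=.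
    by field; rewrite gt_eqF.
  - move=> x; apply: cvgM; first exact: continuous_horner.
    exact: continuous_normal_pdf.
  - exact: poly_phi_integrable.
  - rewrite -[X in _ --> X](mulr0 v); apply: cvgMr.
    have := @phi_poly_vanish p 1 (expr1n _ _).
    by under eq_fun do rewrite mul1r.
  - rewrite -[X in _ --> X](mulr0 v); apply: cvgMr.
    have := @phi_poly_vanish p (-1) (etrans (sqrrN 1) (expr1n _ 2)).
    by under eq_fun do rewrite mulN1r.
have E x : p.[x] * x = (v *: p^`()).[x] - q.[x] by rewrite /q !hornerE; ring.
under eq_integral do rewrite E EFinB.
rewrite integralB//; [|exact: normal_poly_integrable..].
by rewrite q0 sube0; apply: eq_integral => x _; rewrite hornerE.
Qed.

End stein.

(** * Signed integrands and fourth moments *)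

Section signed_resampling.
Context {R : realType} d d' (T : measurableType d) (T' : measurableType d').
Variables (P : probability T R) (q : probability T' R) (U : T * T' -> T).
Hypothesis mU : measurable_fun setT U.
Hypothesis PU : forall f : T -> \bar R, measurable_fun setT f ->
  (forall x, 0 <= f x)%E -> (\int[P]_x f x = \int[P]_x \int[q]_t f (U (x, t)))%E.

(** An identity for nonnegative integrands passes to integrable ones by splitting
into positive and negative parts. The map [U] is abstract because it is used
both on matrices and on pairs of a parameter and a matrix. *)
Lemma resampling_integrable (f : T -> \bar R) : P.-integrable setT f ->
  (\int[P]_x f x = \int[P]_x \int[q]_t f (U (x, t)))%E.
Proof.
move=> intf.
have mf := measurable_int P intf.
have key (g : T -> \bar R) : measurable_fun setT g ->
    (forall x, 0 <= g x)%E -> (\int[P]_x g x < +oo)%E ->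
    P.-integrable setT (fun x => \int[q]_t g (U (x, t)))%E.
  move=> mg g0 goo; apply/integrableP; split.
    apply: (@measurable_fun_fubini_tonelli_F _ _ T T' R q (g \o U)) => [|z].
      exact: measurableT_comp.
    exact: g0.
  under eq_integral do rewrite gee0_abs ?integral_ge0//.
  by rewrite -PU.
rewrite integralE.
rewrite (PU (f := (f^\+)%E)); last 2 first.
- exact: measurable_funepos.
- by move=> M; exact: funepos_ge0.
rewrite (PU (f := (f^\-)%E)); last 2 first.
- exact: measurable_funeneg.
- by move=> M; exact: funeneg_ge0.
rewrite -integralB//.
- apply: eq_integral => M _ /=; rewrite [RHS]integralE.
  by congr (_ - _)%E; apply: eq_integral => s _; rewrite ?funeposE ?funenegE.
- apply: key => //; first exact: measurable_funepos.
  exact: integral_funepos_lt_pinfty.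
- apply: key => //; first exact: measurable_funeneg.
  exact: integral_funeneg_lt_pinfty.
Qed.

End signed_resampling.

Lemma iid_law_resample_integrable (R : realType) a b
    (q : probability (measurableTypeR R) R)
    (nu : probability (borel_mx R a b) R) i j (f : 'M[R]_(a, b) -> \bar R) :
  iid_law q nu ->
  nu.-integrable setT (f : borel_mx R a b -> \bar R) ->
  (\int[nu]_M f M = \int[nu]_M \int[q]_s f (set_entry i j s M))%E.
Proof.
move=> nuq; pose U (z : borel_mx R a b * measurableTypeR R) : borel_mx R a b :=
  set_entry i j z.2 z.1.
have mU : measurable_fun setT U by exact: measurable_set_entry.
by apply: (resampling_integrable mU) => h mh h0; exact: iid_law_resample.
Qed.

Section fourth_moments.
Context {R : realType} d (T : measurableType d).
Variable P : probability T R.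

(** A class closed under linear combinations and such that products of at most four
of its members are integrable; entries of Gaussian matrices belong to it, and
fourth moments are the highest ones that the proof meets. *)
Definition fourth_power_integrable (f : T -> R) : Prop :=
  measurable_fun setT f /\ (\int[P]_x (f x ^+ 4)%:E < +oo)%E.

Local Notation L4 := fourth_power_integrable.

Lemma L4_cst c : L4 (fun=> c).
Proof. by split => //; rewrite integral_cst//= probability_setT mule1 ltry. Qed.

Lemma L4Z k f : L4 f -> L4 (fun x => k * f x).
Proof.
move=> [mf fi]; split; first exact: measurable_funM.
under eq_integral do rewrite exprMn EFinM.
rewrite ge0_integralZl//.
- by rewrite lte_mul_pinfty// lee_fin exprn_even_ge0.
- exact/measurable_EFinP/measurable_funX.
- by move=> x _; rewrite lee_fin exprn_even_ge0.
- by rewrite lee_fin exprn_even_ge0.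
Qed.

Lemma L4D f g : L4 f -> L4 g -> L4 (fun x => f x + g x).
Proof.
move=> [mf fi] [mg gi]; split; first exact: measurable_funD.
apply: (@le_lt_trans _ _ (\int[P]_x ((8 * f x ^+ 4)%:E + (8 * g x ^+ 4)%:E))%E).
  apply: ge0_le_integral => //.
  - by move=> x _; rewrite lee_fin exprn_even_ge0.
  - by apply/measurable_EFinP/measurable_funX; exact: measurable_funD.
  - by apply: emeasurable_funD; apply/measurable_EFinP; apply: measurable_funM => //;
      exact: measurable_funX.
  - (* 8 a^4 + 8 b^4 - (a + b)^4 has the double root a = b, and the cofactor is
       a positive form. *)
    move=> x _; rewrite -EFinD lee_fin -subr_ge0.
    rewrite (_ : _ - _ = (f x - g x) ^+ 2 *
      (7 * f x ^+ 2 + 10 * (f x * g x) + 7 * g x ^+ 2)); last by ring.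
    rewrite mulr_ge0 ?sqr_ge0//.
    rewrite (_ : _ + _ = 2 * f x ^+ 2 + 5 * (f x + g x) ^+ 2 + 2 * g x ^+ 2); last by ring.
    by rewrite !addr_ge0// mulr_ge0// sqr_ge0.
rewrite ge0_integralD//.
- under eq_integral do rewrite EFinM.
  under [X in (_ + X)%E]eq_integral do rewrite EFinM.
  rewrite !ge0_integralZl//.
  + by rewrite lte_add_pinfty// lte_mul_pinfty.
  + exact/measurable_EFinP/measurable_funX.
  + by move=> x _; rewrite lee_fin exprn_even_ge0.
  + exact/measurable_EFinP/measurable_funX.
  + by move=> x _; rewrite lee_fin exprn_even_ge0.
- by move=> x _; rewrite lee_fin mulr_ge0// exprn_even_ge0.
- by apply/measurable_EFinP; apply: measurable_funM => //; exact: measurable_funX.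
- by move=> x _; rewrite lee_fin mulr_ge0// exprn_even_ge0.
- by apply/measurable_EFinP; apply: measurable_funM => //; exact: measurable_funX.
Qed.

Lemma L4_sum (I : Type) (r : seq I) (f : I -> T -> R) :
  (forall i, L4 (f i)) -> L4 (fun x => \sum_(i <- r) f i x).
Proof.
move=> Lf; elim: r => [|i r IH].
  by under eq_fun do rewrite big_nil; exact: L4_cst.
by under eq_fun do rewrite big_cons; exact: L4D.
Qed.

Lemma L4_integrable f : L4 f -> P.-integrable setT (fun x => (f x ^+ 4)%:E).
Proof.
move=> [mf fi]; apply/integrableP; split.
  exact/measurable_EFinP/measurable_funX.
by under eq_integral do rewrite /= ger0_norm ?exprn_even_ge0//.
Qed.

Lemma L4_prod4 f1 f2 f3 f4 : L4 f1 -> L4 f2 -> L4 f3 -> L4 f4 ->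
  P.-integrable setT (fun x => (f1 x * f2 x * f3 x * f4 x)%:E).
Proof.
move=> L1 L2 L3 L4'.
apply: (le_integrable measurableT _ _ (integrableD measurableT
  (integrableD measurableT (L4_integrable L1) (L4_integrable L2))
  (integrableD measurableT (L4_integrable L3) (L4_integrable L4')))).
  case: L1 L2 L3 L4' => m1 _ [m2 _] [m3 _] [m4 _].
  by apply/measurable_EFinP; do 3 apply: measurable_funM => //.
move=> x _; rewrite /= lee_fin [leRHS]ger0_norm; last first.
  by rewrite !addr_ge0// exprn_even_ge0.
move: (f1 x) (f2 x) (f3 x) (f4 x) => a b c e.
have amgm (x1 x2 : R) : `|x1 * x2| <= x1 ^+ 2 + x2 ^+ 2.
  rewrite ler_norml; apply/andP; split.
    rewrite lerNl -subr_ge0.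
    rewrite (_ : _ - _ = ((x1 + x2) ^+ 2 + x1 ^+ 2 + x2 ^+ 2) / 2); last by field.
    by rewrite divr_ge0// !addr_ge0// sqr_ge0.
  rewrite -subr_ge0 (_ : _ - _ = ((x1 - x2) ^+ 2 + x1 ^+ 2 + x2 ^+ 2) / 2); last by field.
  by rewrite divr_ge0// !addr_ge0// sqr_ge0.
rewrite -[a * b * c * e]mulrA (le_trans (amgm _ _))//.
apply: lerD.
  have := amgm (a ^+ 2) (b ^+ 2).
  by rewrite -exprMn ger0_norm ?sqr_ge0// -!exprM.
have := amgm (c ^+ 2) (e ^+ 2).
by rewrite -exprMn ger0_norm ?sqr_ge0// -!exprM.
Qed.

End fourth_moments.

(** * Isserlis' formula for linear forms of a Gaussian matrix *)

Section isserlis.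
Context {R : realType} {m n : nat}.
Variables (v : R) (nu : probability (borel_mx R m n) R).
Hypothesis v0 : 0 < v.
Hypothesis nuN : iid_law (normal_prob 0 (Num.sqrt v)) nu.
Local Notation L4 := (@fourth_power_integrable R _ (borel_mx R m n) nu).
Implicit Types (X Y Z : 'M[R]_(m, n)) (k : R).

Definition frob X Y : R := \sum_ij X ij.1 ij.2 * Y ij.1 ij.2.

Definition affine_form X k (M : 'M[R]_(m, n)) : R := frob X M + k.

Lemma L4_coord i j : L4 (fun M : 'M[R]_(m, n) => M i j).
Proof.
split; first exact: measurable_coord.
rewrite (iid_law_resample i j nuN); last 2 first.
- by apply/measurable_EFinP/measurable_funX; exact: measurable_coord.
- by move=> M; rewrite lee_fin exprn_even_ge0.
under eq_integral do under eq_integral do rewrite mxE !eqxx/=.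
rewrite integral_cst//= probability_setT mule1.
have /integrableP[_] := normal_poly_integrable v0 ('X^4).
apply: le_lt_trans; rewrite le_eqVlt; apply/orP; left; apply/eqP.
apply: eq_integral => s _; rewrite hornerXn /= ger0_norm//.
by rewrite exprn_even_ge0.
Qed.

Lemma L4_affine_form X k : L4 (affine_form X k).
Proof.
apply: L4D; last exact: L4_cst.
by apply: L4_sum => -[i j]; apply: L4Z; exact: L4_coord.
Qed.

Lemma affine_form_set_entry X k i j s M :
  affine_form X k (set_entry i j s M) =
  X i j * s + affine_form X k (set_entry i j 0 M).
Proof.
rewrite /affine_form addrA; congr (_ + _).
rewrite /frob (bigD1 (i, j))//= [in RHS](bigD1 (i, j))//= !mxE !eqxx/= mulr0 add0r.
congr (_ + _); apply: eq_bigr => -[k1 l] /=.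
by rewrite xpair_eqE !mxE => /negbTE ->.
Qed.

(** Redraw the entry [(i, j)]: the three forms become affine functions of it, and
Stein's identity applies to their product as a polynomial in that entry. *)
Lemma coord_stein i j X k Y l Z h :
  (\int[nu]_M (M i j * affine_form X k M * affine_form Y l M * affine_form Z h M)%:E =
   \int[nu]_M (v * (X i j * affine_form Y l M * affine_form Z h M +
     Y i j * affine_form X k M * affine_form Z h M +
     Z i j * affine_form X k M * affine_form Y l M))%:E)%E.
Proof.
have int1 : nu.-integrable setT (fun M : borel_mx R m n =>
    (M i j * affine_form X k M * affine_form Y l M * affine_form Z h M)%:E).
  by apply: L4_prod4; [exact: L4_coord|exact: L4_affine_form..].
have int2 : nu.-integrable setT (fun M : borel_mx R m n =>
    (v * (X i j * affine_form Y l M * affine_form Z h M +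
     Y i j * affine_form X k M * affine_form Z h M +
     Z i j * affine_form X k M * affine_form Y l M))%:E).
  under eq_fun do rewrite EFinM; apply: integrableZl => //.
  have prod2 (c : R) X1 X2 k1 k2 : nu.-integrable setT (fun M : borel_mx R m n =>
      (c * affine_form X1 k1 M * affine_form X2 k2 M)%:E).
    have := L4_prod4 (L4_cst nu c) (L4_affine_form X1 k1) (L4_affine_form X2 k2)
      (L4_cst nu 1).
    by under eq_fun do rewrite mulr1.
  under eq_fun do rewrite !EFinD.
  by apply: integrableD => //; apply: integrableD.
rewrite (@iid_law_resample_integrable _ _ _ _ _ i j _ nuN int1).
rewrite (@iid_law_resample_integrable _ _ _ _ _ i j _ nuN int2).
apply: eq_integral => M _.
pose form (W : 'M[R]_(m, n)) w : {poly R} :=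
  W i j *: 'X + (affine_form W w (set_entry i j 0 M))%:P.
have formE W w s : affine_form W w (set_entry i j s M) = (form W w).[s].
  by rewrite affine_form_set_entry !hornerE.
pose p := form X k * form Y l * form Z h.
transitivity (\int[normal_prob 0 (Num.sqrt v)]_s (p.[s] * s)%:E)%E.
  apply: eq_integral => s _; congr EFin.
  by rewrite !formE /p !hornerM mxE !eqxx/=; ring.
rewrite normal_stein//; apply: eq_integral => s _; congr (_ * _)%:E.
have dform W w : (form W w)^`() = (W i j)%:P.
  by rewrite /form derivD derivC addr0 derivZ derivX alg_polyC.
rewrite /p !derivM !dform !hornerE !formE.
by rewrite /p /form !hornerE; ring.
Qed.

(** The linear combination of [coord_stein] over all entries: Gaussian integration
by parts in the direction [W]. Affine rather than linear forms are
needed so that the constant form [1] is among them. *)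
Lemma linear_stein W X k Y l Z h :
  (\int[nu]_M (frob W M * affine_form X k M * affine_form Y l M * affine_form Z h M)%:E =
   \int[nu]_M (v * (frob W X * affine_form Y l M * affine_form Z h M +
     frob W Y * affine_form X k M * affine_form Z h M +
     frob W Z * affine_form X k M * affine_form Y l M))%:E)%E.
Proof.
have prod2 (c : R) X1 X2 k1 k2 : nu.-integrable setT (fun M : borel_mx R m n =>
    (c * affine_form X1 k1 M * affine_form X2 k2 M)%:E).
  have := L4_prod4 (L4_cst nu c) (L4_affine_form X1 k1) (L4_affine_form X2 k2)
    (L4_cst nu 1).
  by under eq_fun do rewrite mulr1.
transitivity (\int[nu]_M \sum_ij ((W ij.1 ij.2)%:E * ((M : 'M[R]_(m, n)) ij.1 ij.2 *
    affine_form X k M * affine_form Y l M * affine_form Z h M)%:E))%E.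
  apply: eq_integral => M _; under [RHS]eq_bigr do rewrite -EFinM.
  rewrite sumEFin /frob !mulr_suml; congr EFin.
  by apply: eq_bigr => ij _; rewrite !mulrA.
rewrite integral_sum//; last first.
  move=> ij; apply: integrableZl => //.
  by apply: L4_prod4; [exact: L4_coord|exact: L4_affine_form..].
transitivity (\sum_ij \int[nu]_M ((W ij.1 ij.2)%:E *
    (v * (X ij.1 ij.2 * affine_form Y l M * affine_form Z h M +
     Y ij.1 ij.2 * affine_form X k M * affine_form Z h M +
     Z ij.1 ij.2 * affine_form X k M * affine_form Y l M))%:E))%E.
  apply: eq_bigr => ij _; rewrite !integralZl//.
  - by rewrite coord_stein.
  - under eq_fun do rewrite EFinM; apply: integrableZl => //.
    under eq_fun do rewrite !EFinD.
    by apply: integrableD => //; apply: integrableD.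
  - by apply: L4_prod4; [exact: L4_coord|exact: L4_affine_form..].
rewrite -integral_sum//; last first.
  move=> ij; apply: integrableZl => //.
  under eq_fun do rewrite EFinM; apply: integrableZl => //.
  under eq_fun do rewrite !EFinD.
  by apply: integrableD => //; apply: integrableD.
apply: eq_integral => M _; under eq_bigr do rewrite -EFinM.
rewrite sumEFin /frob !mulr_suml -!big_split/= mulr_sumr; congr EFin.
by apply: eq_bigr => ij _; ring.
Qed.

Lemma affine_form_linear X M : affine_form X 0 M = frob X M.
Proof. by rewrite /affine_form addr0. Qed.

Lemma affine_form_cst k M : affine_form 0 k M = k.
Proof.
rewrite /affine_form /frob big1 ?add0r// => ij _.
by rewrite mxE mul0r.
Qed.

Lemma frob0 X : frob X 0 = 0.
Proof. by rewrite /frob big1// => ij _; rewrite mxE mulr0. Qed.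

Lemma covariance_frob X Y :
  (\int[nu]_M (frob X M * frob Y M)%:E = (v * frob X Y)%:E)%E.
Proof.
have := linear_stein X Y 0 0 1 0 1.
under eq_integral do rewrite !affine_form_cst affine_form_linear !mulr1.
move=> ->.
under eq_integral do rewrite !affine_form_cst !frob0 !mul0r !addr0 !mulr1.
by rewrite integral_cst//= probability_setT mule1.
Qed.

Definition row_form (k : 'I_m) (a : 'cV[R]_n) : 'M[R]_(m, n) :=
  delta_mx k ord0 *m a^T.

Lemma frob_row_form i a M : frob (row_form i a) M = (M *m a) i ord0.
Proof.
rewrite /frob -(pair_bigA _ (fun r c => row_form i a r c * M r c))/=.
rewrite (bigD1 i)//= [X in _ + X]big1 ?addr0 => [|k ki].
  by rewrite mxE; apply: eq_bigr => l _; rewrite outerE mxE !eqxx mul1r mulrC.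
by apply: big1 => l _; rewrite outerE mxE (negbTE ki) !mul0r.
Qed.

Lemma frob_row_formC i j a b :
  frob (row_form i a) (row_form j b) = (i == j)%:R * dot a b.
Proof.
rewrite frob_row_form -mulmxA (_ : b^T *m a = (dot a b)%:M).
  by rewrite mul_mx_scalar !mxE eqxx andbT mulrC.
by rewrite [LHS]mx11_scalar dotC dotE.
Qed.

(** [M a] and [M b] are independent of [M y], which has variance [v |y|^2] in each
coordinate. In the proof only the pairing of [y] with itself survives in
Isserlis' formula, because [a] and [b] are orthogonal to [y]. *)
Lemma covariance_dot (a b y : 'cV[R]_n) : dot a y = 0 -> dot b y = 0 ->
  (\int[nu]_M (dot (M *m a) (M *m y) * dot (M *m b) (M *m y))%:E =
   (v ^+ 2 * m%:R * dot y y * dot a b)%:E)%E.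
Proof.
move=> ay by0.
transitivity (\int[nu]_M \sum_(k < m) \sum_(l < m)
  (frob (row_form k y) M * affine_form (row_form k a) 0 M *
   affine_form (row_form l y) 0 M * affine_form (row_form l b) 0 M)%:E)%E.
  apply: eq_integral => M _.
  under [RHS]eq_bigr do rewrite sumEFin.
  rewrite sumEFin /dot mulr_suml; congr EFin; apply: eq_bigr => k _.
  rewrite mulr_sumr; apply: eq_bigr => l _.
  by rewrite !affine_form_linear !frob_row_form; ring.
have int4 (k l : 'I_m) : nu.-integrable setT (fun M : borel_mx R m n =>
    (frob (row_form k y) M * affine_form (row_form k a) 0 M *
   affine_form (row_form l y) 0 M * affine_form (row_form l b) 0 M)%:E).
  under eq_fun do rewrite -affine_form_linear.
  by apply: L4_prod4; exact: L4_affine_form.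
rewrite integral_sum//; last by move=> k; apply: integrable_sum.
under eq_bigr do rewrite integral_sum//.
under eq_bigr => k _ do under eq_bigr => l _ do rewrite linear_stein.
under eq_bigr => k _.
  under eq_bigr => l _.
    under eq_integral do rewrite !frob_row_formC [dot y a]dotC [dot y b]dotC ay by0
      !mulr0 !mul0r addr0 add0r !affine_form_linear.
    rewrite (_ : (fun M => _) = (fun M => (v * ((k == l)%:R * dot y y))%:E *
      (frob (row_form k a) M * frob (row_form l b) M)%:E)%E); last first.
      by apply/funext => M; rewrite -EFinM; congr EFin; ring.
    rewrite integralZl//; last first.
      have := L4_prod4 (L4_cst nu 1) (L4_cst nu 1) (L4_affine_form (row_form k a) 0)
         (L4_affine_form (row_form l b) 0).
      by under eq_fun do rewrite !mul1r !affine_form_linear.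
    rewrite covariance_frob frob_row_formC -EFinM.
    over.
  rewrite sumEFin (bigD1 k)//= big1 ?addr0; last first.
    by move=> l /negbTE; rewrite eq_sym => ->; rewrite !mul0r mulr0 mul0r.
  rewrite eqxx !mul1r.
  over.
rewrite sumEFin sumr_const card_ord; congr EFin; rewrite -mulr_natr; ring.
Qed.

End isserlis.

(** * The Gram matrix and its least eigenvalue *)

Section positive_forms.
Context {R : realType} {d : nat}.
Implicit Types (x y : 'cV[R]_d) (N K : 'M[R]_d).

Lemma dot_trmx N x y : dot x (N *m y) = dot (N^T *m x) y.
Proof. by rewrite dot_mulmxl trmxK. Qed.

Lemma dot_coord_le x i : x i ord0 ^+ 2 <= dot x x.
Proof.
rewrite /dot (bigD1 i)//= -expr2 lerDl sumr_ge0// => j _.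
by rewrite -expr2 sqr_ge0.
Qed.

(** Any finite constant will do: it serves to bound the inverse of a form. *)
Lemma quadratic_form_bound K : exists2 C : R, 0 < C &
  forall x, dot x (K *m x) <= C * dot x x.
Proof.
exists (1 + \sum_i \sum_j `|K i j|).
  by rewrite ltr_pwDl// sumr_ge0// => i _; rewrite sumr_ge0.
move=> x; rewrite mulrDl mul1r.
have le : dot x (K *m x) <= (\sum_i \sum_j `|K i j|) * dot x x.
  rewrite {1}/dot mulr_suml; apply: ler_sum => i _.
  rewrite mxE mulr_sumr mulr_suml; apply: ler_sum => j _.
  rewrite mulrCA; apply: (le_trans (ler_norm _)); rewrite normrM ler_wpM2l//.
  have := dot_coord_le x i; have := dot_coord_le x j.
  move: (x i ord0) (x j ord0) (dot x x) => s t D; move=> tD sD.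
  rewrite ler_norml; apply/andP; split; nra.
by rewrite (le_trans le)// lerDr dotxx_ge0.
Qed.

(** The form may be degenerate at [y], and then [x, y] must be orthogonal for it:
otherwise the quadratic polynomial in [t] would be affine and take the value
[-1]. *)
Lemma psd_cauchy_schwarz N x y : N^T = N -> (forall z, 0 <= dot z (N *m z)) ->
  dot x (N *m y) ^+ 2 <= dot x (N *m x) * dot y (N *m y).
Proof.
move=> Nsym N0.
have sym : dot y (N *m x) = dot x (N *m y) by rewrite dot_trmx Nsym dotC.
have q (t : R) : 0 <= dot x (N *m x) - 2 * t * dot x (N *m y) + t ^+ 2 * dot y (N *m y).
  have := N0 (x - t *: y).
  rewrite mulmxBr -scalemxAr !(dotDl, dotDr, dotNl, dotNr, dotZl, dotZr) sym.
  by congr (_ <= _); ring.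
have := N0 y; rewrite le_eqVlt => /predU1P[y0|y0].
  rewrite -y0 mulr0; have [->|xy] := eqVneq (dot x (N *m y)) 0; first by rewrite expr0n.
  have := q ((dot x (N *m x) + 1) / (2 * dot x (N *m y))).
  rewrite -y0 mulr0 addr0 (_ : _ - _ = -1); last by field.
  by rewrite oppr_ge0 ler10.
have := q (dot x (N *m y) / dot y (N *m y)).
rewrite (_ : _ + _ = (dot x (N *m x) * dot y (N *m y) - dot x (N *m y) ^+ 2) /
  dot y (N *m y)); last first.
  by field; rewrite gt_eqF.
by rewrite pmulr_lge0 ?invr_gt0// subr_ge0.
Qed.

End positive_forms.

Section gram.
Context {R : realType} {n d : nat}.
Variable A : 'M[R]_(n, d).
Hypotheses (d0 : (0 < d)%N) (rA : \rank A = d).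
Local Notation G := (A^T *m A).

Lemma full_rank_inj (x : 'cV[R]_d) : A *m x = 0 -> x = 0.
Proof.
move=> Ax; have : row_free A^T by rewrite /row_free mxrank_tr rA.
move=> /row_free_inj h; apply/trmx_inj; rewrite trmx0.
by apply: (h _ _ 0); rewrite mul0mx -trmx_mul Ax trmx0.
Qed.

Lemma dot_gram (x : 'cV[R]_d) : dot x (G *m x) = dot (A *m x) (A *m x).
Proof. by rewrite -mulmxA dot_mulmxl. Qed.

Lemma gram_sym : G^T = G.
Proof. by rewrite trmx_mul trmxK. Qed.

Lemma gram_unit : G \in unitmx.
Proof.
rewrite -row_free_unit -kermx_eq0; apply/eqP/row_matrixP => i; rewrite row0.
set r := row i _; have rG : r *m G = 0 by rewrite /r -row_mul mulmx_ker row0.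
have /dotxx_eq0/full_rank_inj : dot (A *m r^T) (A *m r^T) = 0.
  by rewrite -dot_gram dotC -{1}gram_sym -trmx_mul rG trmx0 dot0l.
by move/(congr1 trmx); rewrite trmxK trmx0.
Qed.

Lemma eigenvalue_gram a : eigenvalue G a ->
  exists2 x : 'cV[R]_d, 0 < dot x x & dot (A *m x) (A *m x) = a * dot x x.
Proof.
move=> /eigenvalueP[v vG v0]; exists v^T.
  rewrite lt_def dotxx_ge0 andbT; apply: contra_neq v0 => /dotxx_eq0.
  by move/(congr1 trmx); rewrite trmxK trmx0.
rewrite -dot_gram dotC -{1}gram_sym -trmx_mul vG linearZ/=.
by rewrite dotZl.
Qed.

Let rayleigh := [set dot (A *m x) (A *m x) | x in [set x : 'cV[R]_d | dot x x = 1]].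
Let r := inf rayleigh.

Let rayleigh_lb : lbound rayleigh 0.
Proof. by move=> _ [x _ <-]; exact: dotxx_ge0. Qed.

Let rayleigh0 : rayleigh !=set0.
Proof.
pose e : 'cV[R]_d := delta_mx (Ordinal d0) ord0.
exists (dot (A *m e) (A *m e)); exists e => //=.
by rewrite dot_deltal mxE !eqxx.
Qed.

Let rayleigh_le x : r * dot x x <= dot (A *m x) (A *m x).
Proof.
have [->|x0] := eqVneq x 0.
  by rewrite dot0l mulr0 dotxx_ge0.
have dx : 0 < dot x x.
  by rewrite lt_def dotxx_ge0 andbT; apply: contra_neq x0; exact: dotxx_eq0.
pose y := (Num.sqrt (dot x x))^-1 *: x.
have s2 : Num.sqrt (dot x x) ^+ 2 = dot x x by rewrite sqr_sqrtr ?ltW.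
have : r <= dot (A *m y) (A *m y).
  apply: ge_inf; first by exists 0.
  exists y => //=; rewrite /y dotZl dotZr mulrA -expr2 exprVn s2 mulVf// gt_eqF//.
rewrite /y -scalemxAr dotZl dotZr mulrA -expr2 exprVn s2.
by rewrite mulrC -ler_pdivlMr.
Qed.

Let rayleigh_eigen : eigenvalue G r.
Proof.
apply: contraT => /negPn; rewrite /eigenspace kermx_eq0 row_free_unit => Nu.
set N := G - r%:M in Nu.
have Nsym : N^T = N by rewrite linearB/= gram_sym tr_scalar_mx.
have NE x : dot x (N *m x) = dot (A *m x) (A *m x) - r * dot x x.
  by rewrite mulmxBl dotDr dotNr dot_gram mul_scalar_mx dotZr.
have N0 x : 0 <= dot x (N *m x) by rewrite NE subr_ge0.
have [C C0 KC] := quadratic_form_bound (invmx N).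
suff : r + C^-1 <= r by rewrite gerDl leNgt invr_gt0 C0.
apply: lb_le_inf => // _ [x /= x1 <-].
rewrite -lerBrDl -[r]mulr1 -x1 -NE -[C^-1]mul1r ler_pdivrMr//.
have := psd_cauchy_schwarz x (invmx N *m x) Nsym N0.
rewrite mulmxA mulmxV// mul1mx x1 expr1n => /le_trans; apply.
rewrite ler_wpM2l//; rewrite dotC.
by have := KC x; rewrite x1 mulr1.
Qed.

(** The infimum [r] of the Rayleigh quotient is an eigenvalue of [G]. If it were
not, [N = G - r] would be an invertible positive form, and Cauchy-Schwarz for
[N] applied to [x] and [N^-1 x] would give [|x|^4 <= <x, N x> <x, N^-1 x>].
The last factor is at most [C |x|^2], so [<x, N x>] would be bounded below by
[1/C] on the unit sphere, and [r] would not be the infimum. No compactness is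
involved, and [r] is below every eigenvalue. *)
Lemma min_eigenvalue_gram : 0 < min_eigenvalue G /\
  forall x, min_eigenvalue G * dot x x <= dot (A *m x) (A *m x).
Proof.
have -> : min_eigenvalue G = r.
  apply/eqP; rewrite eq_le; apply/andP; split.
    apply: ge_inf => //; exists r => a /= /eigenvalue_gram[x x0 xE].
    by rewrite -(ler_pM2r x0) -xE.
  apply: lb_le_inf; first by exists r.
  move=> a /= /eigenvalue_gram[x x0 xE].
  by rewrite -(ler_pM2r x0) -xE.
split => //.
have [x x0 xE] := eigenvalue_gram rayleigh_eigen.
rewrite -(pmulr_lgt0 _ x0) -xE lt_def dotxx_ge0 andbT.
apply/eqP => /dotxx_eq0/full_rank_inj xz; move: x0.
by rewrite xz dot0l ltxx.
Qed.

(** For [x] the [i]-th column of [G^-1], the entry [x_i] equals [|A x|^2], which is at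
least the least eigenvalue times [|x|^2], hence times [x_i^2]. *)
Lemma inv_gram_diag i : (invmx G) i i <= (min_eigenvalue G)^-1.
Proof.
have [l0 lP] := min_eigenvalue_gram.
pose e : 'cV[R]_d := delta_mx i ord0.
pose x := invmx G *m e.
have xi : x i ord0 = (invmx G) i i by rewrite /x -colE mxE.
have dx : dot (A *m x) (A *m x) = x i ord0.
  by rewrite -dot_gram {2}/x mulmxA mulmxV ?gram_unit// mul1mx dotC dot_deltal.
rewrite -xi.
have x0 : 0 <= x i ord0 by rewrite -dx dotxx_ge0.
have := lP x; rewrite dx => /(le_trans (ler_wpM2l (ltW l0) (dot_coord_le x i))).
move: x0; rewrite le_eqVlt => /predU1P[<- _|x0]; first by rewrite invr_ge0 ltW.
by rewrite expr2 mulrA ger_pMl// mulrC -ler_pdivlMr// mul1r.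
Qed.

Lemma dot_inv_gram (x : 'cV[R]_d) :
  dot (A *m (invmx G *m x)) (A *m (invmx G *m x)) = dot x (invmx G *m x).
Proof. by rewrite -dot_gram mulmxA mulmxV ?gram_unit// mul1mx dotC. Qed.

End gram.

(** * Measurability of estimators *)

Section estimators.
Context {R : realType} {m d : nat}.

Lemma continuous_lsubmx p q : continuous (@lsubmx R m p q).
Proof.
move=> M A [P PM PA].
exists (fun i j => if fintype.split j is inl k then P i k else setT) => [i j /=|N /= hN].
  case: (split_ordP j) => k ->.
    by have := PM i k; rewrite mxE.
  exact: filterT.
apply: PA => i k; have := hN i (lshift q k).
by rewrite mxE (unsplitK (inl k) : fintype.split (lshift _ k) = _).
Qed.

Lemma continuous_rsubmx p q : continuous (@rsubmx R m p q).
Proof.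
move=> M A [P PM PA].
exists (fun i j => if fintype.split j is inr k then P i k else setT) => [i j /=|N /= hN].
  case: (split_ordP j) => k ->.
    exact: filterT.
  by have := PM i k; rewrite mxE.
apply: PA => i k; have := hN i (rshift p k).
by rewrite mxE (unsplitK (inr k) : fintype.split (rshift _ k) = _).
Qed.

(** The Borel sets of a product of two spaces of matrices are generated by its open
sets rather than by rectangles. Since a pair of matrices is a continuous function of their
juxtaposition, and the latter is measurable as soon as its entries are,
measurability of the two components suffices. *)
Lemma measurable_estimator_comp (g : 'M[R]_(m, d) * 'cV[R]_m -> 'cV[R]_d)
    d' (T : measurableType d') (f1 : T -> 'M[R]_(m, d)) (f2 : T -> 'cV[R]_m) :
  measurable_estimator g ->
  measurable_fun setT (f1 : T -> borel_mx R m d) ->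
  measurable_fun setT (f2 : T -> borel_mx R m 1) ->
  measurable_fun setT ((fun t => g (f1 t, f2 t)) : T -> borel_mx R d 1).
Proof.
move=> mg mf1 mf2.
pose h (M : 'M[R]_(m, d + 1)) := (lsubmx M, rsubmx M).
have ch : continuous h.
  move=> M; exact: cvg_pair (@continuous_lsubmx d 1 M) (@continuous_rsubmx d 1 M).
have mh : measurable_fun setT (h : borel_mx R m (d + 1) ->
    g_sigma_algebraType (@open ('M[R]_(m, d) * 'cV[R]_m)%type)).
  apply: (@measurability _ _ (borel_mx R m (d + 1))
    (g_sigma_algebraType (@open ('M[R]_(m, d) * 'cV[R]_m)%type))
    setT h (@open ('M[R]_(m, d) * 'cV[R]_m)%type)) => //.
  move=> _ [U oU <-]; rewrite setTI; apply: sub_sigma_algebra.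
  by move/continuousP : ch => /(_ U oU).
have mr : measurable_fun setT ((fun t => row_mx (f1 t) (f2 t)) : T -> borel_mx R m (d + 1)).
  apply: measurable_mxP => i j; case: (split_ordP j) => k ->.
    under eq_fun do rewrite row_mxEl.
    exact: measurableT_comp (measurable_coord i k) mf1.
  under eq_fun do rewrite row_mxEr.
  exact: measurableT_comp (measurable_coord i k) mf2.
have -> : (fun t => g (f1 t, f2 t)) = g \o (h \o (fun t => row_mx (f1 t) (f2 t))).
  by apply/funext => t /=; rewrite /h row_mxKl row_mxKr.
by apply: (measurableT_comp mg); exact: measurableT_comp mh mr.
Qed.

End estimators.

(** * The van Trees identity *)

Section posterior_score.
Context {R : realType} {n d m : nat}.
Variables (A : 'M[R]_(n, d)) (y : 'cV[R]_n) (v B : R).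
Hypotheses (v0 : 0 < v) (B0 : 0 < B) (y0 : 0 < dot y y) (Ay : A^T *m y = 0).
Variables (q : probability (measurableTypeR R) R)
  (mu : probability (borel_mx R d 1) R) (nu : probability (borel_mx R m n) R).
Hypotheses (qE : prior_law B q) (muq : iid_law q mu)
  (nuN : iid_law (normal_prob 0 (Num.sqrt v)) nu).
Variable g : 'M[R]_(m, d) * 'cV[R]_m -> 'cV[R]_d.
Hypothesis mg : measurable_estimator g.
Local Notation Pi := (mu \x nu)%E.
Local Notation Z := (borel_mx R d 1 * borel_mx R m n)%type.

Let c := dot y y * v.
Let c0 : 0 < c. Proof. exact: mulr_gt0. Qed.

Definition estimate (x : 'cV[R]_d) (S : 'M[R]_(m, n)) : 'cV[R]_d :=
  g (S *m A, S *m (A *m x + y)).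

(** With [c = |y|^2 v], this is [c] times the derivative in [x_i] of the logarithm
of the joint density of the parameter and the data [(S A, S (A x + y))]. *)
Definition score (x : 'cV[R]_d) (S : 'M[R]_(m, n)) (i : 'I_d) : R :=
  dot (S *m col i A) (S *m y) + c * prior_score B (x i ord0).

Section coordinate.
Variable i : 'I_d.
Let a := col i A.

Let ay : dot a y = 0.
Proof. by rewrite /a colE dot_mulmxl Ay dot0r. Qed.

Let ya : dot y a = 0. Proof. by rewrite dotC ay. Qed.

Let yA : y^T *m A = 0.
Proof. by rewrite -(trmxK (y^T *m A)) trmx_mul trmxK Ay trmx0. Qed.

Let aA x : A *m x = A *m set_entry i ord0 0 x + x i ord0 *: a.
Proof.
rewrite /a colE scalemxAr -mulmxDr; congr (_ *m _).
apply/colP => j; rewrite !mxE eqxx andbT; case: eqVneq => [->|_].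
  by rewrite mulr1 add0r.
by rewrite mulr0 addr0.
Qed.

Let E (S : 'M[R]_(m, n)) := dot (S *m a) (S *m y).
Let V (S : 'M[R]_(m, n)) := dot (S *m a) (S *m a).
Let base (x : 'cV[R]_d) (S : 'M[R]_(m, n)) : R := estimate (set_entry i ord0 0 x) S i ord0.
Let ratio (t : R) (S : 'M[R]_(m, n)) := expR ((t * E S - t ^+ 2 * V S / 2) / c).
(* Right multiplication by T t adds t S a to S y and fixes S A. *)
Let T (t : R) : 'M[R]_n := 1%:M + a *m ((t / dot y y) *: y)^T.

Let err_score (z : Z) : R := (estimate z.1 z.2 i ord0 - z.1 i ord0) * score z.1 z.2 i.
Let H (x : 'cV[R]_d) (S : 'M[R]_(m, n)) := (base x S - x i ord0) *
  (E S - x i ord0 * V S + c * prior_score B (x i ord0)).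
Let k (z : Z) : R := H z.1 z.2 * ratio (z.1 i ord0) z.2.

Let mS : measurable_fun setT ((fun z => z.2) : Z -> borel_mx R m n).
Proof. exact: measurable_snd. Qed.

Let mx : measurable_fun setT ((fun z => z.1) : Z -> borel_mx R d 1).
Proof. exact: measurable_fst. Qed.

Let mxi : measurable_fun setT (fun z : Z => z.1 i ord0).
Proof. exact: measurableT_comp (measurable_coord i ord0) mx. Qed.

Let mSmul p (C : 'M[R]_(n, p)) :
  measurable_fun setT ((fun z => z.2 *m C) : Z -> borel_mx R m p).
Proof. by apply: measurable_mulmx => //; exact: measurable_cst. Qed.

Let mE : measurable_fun setT (fun z : Z => E z.2).
Proof. by apply: measurable_dot; exact: mSmul. Qed.

Let mV : measurable_fun setT (fun z : Z => V z.2).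
Proof. by apply: measurable_dot; exact: mSmul. Qed.

Let mscore : measurable_fun setT (fun z : Z => prior_score B (z.1 i ord0)).
Proof. exact: measurableT_comp (@measurable_prior_score _ B) mxi. Qed.

Let mest (f : Z -> 'cV[R]_d) : measurable_fun setT (f : Z -> borel_mx R d 1) ->
  measurable_fun setT (fun z : Z => estimate (f z) z.2 i ord0).
Proof.
move=> mf; apply: (measurableT_comp (measurable_coord i ord0)).
apply: measurable_estimator_comp => //.
apply: measurable_mulmx => //; apply: measurable_addmx; last exact: measurable_cst.
by apply: measurable_mulmx => //; exact: measurable_cst.
Qed.

Let mH : measurable_fun setT (fun z : Z => H z.1 z.2).
Proof.
apply: measurable_funM.
  apply: measurable_funB => //; apply: mest.
  by apply: measurable_set_entry.
apply: measurable_funD.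
  by apply: measurable_funB => //; exact: measurable_funM.
by apply: measurable_funM => //; exact: measurable_cst.
Qed.

Let mratio (t : Z -> R) : measurable_fun setT t ->
  measurable_fun setT (fun z : Z => ratio (t z) z.2).
Proof.
move=> mt; apply: measurableT_comp => //.
apply: measurable_funM; last exact: measurable_cst.
apply: measurable_funB; first exact: measurable_funM.
apply: measurable_funM; last exact: measurable_cst.
by apply: measurable_funM => //; exact: measurable_funX.
Qed.

Let mk : measurable_fun setT k.
Proof. by apply: measurable_funM => //; exact: mratio. Qed.

Let merr : measurable_fun setT err_score.
Proof.
apply: measurable_funM.
  by apply: measurable_funB => //; exact: mest.
by apply: measurable_funD => //; apply: measurable_funM => //; exact: measurable_cst.
Qed.

Let HT x S : H x (S *m T (x i ord0)) = err_score (x, S).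
Proof.
have TA : T (x i ord0) *m A = A.
  by rewrite mulmxDl mul1mx linearZ/= -mulmxA -scalemxAl yA scaler0 mulmx0 addr0.
have Ta : T (x i ord0) *m a = a by rewrite /a colE mulmxA TA.
have Ty : T (x i ord0) *m y = y + x i ord0 *: a.
  rewrite mulmxDl mul1mx; congr (_ + _).
  rewrite linearZ/= -scalemxAr -scalemxAl -mulmxA (_ : y^T *m y = (dot y y)%:M).
    by rewrite mul_mx_scalar scalerA divfK// gt_eqF.
  by rewrite [LHS]mx11_scalar dotE.
rewrite /H /base /estimate /E /V /err_score /score/= -!mulmxA TA Ta Ty.
have -> : T (x i ord0) *m (A *m set_entry i ord0 0 x + y) = A *m x + y.
  by rewrite mulmxDr mulmxA TA Ty addrCA [X in _ = X + _]aA -!addrA [y + _]addrC -addrA.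
rewrite [S *m (y + _)]mulmxDr -scalemxAr dotDr dotZr; congr (_ * _); ring.
Qed.

Let ratio_cv t S : ratio t S = expR ((dot (S *m a) (S *m ((t / dot y y) *: y)) -
   dot (S *m a) (S *m a) * dot ((t / dot y y) *: y) ((t / dot y y) *: y) / 2) / v).
Proof.
rewrite /ratio /E /V -scalemxAr !dotZr dotZl /c; congr expR.
by field; rewrite !gt_eqF.
Qed.

Let uT t : dot ((t / dot y y) *: y) a = 0.
Proof. by rewrite dotZl ya mulr0. Qed.

(* phi is the absolute value, for integrability, or a positive or negative part;
   all three commute with the positive factor ratio. *)
Let shear_transfer (phi : R -> R) : measurable_fun setT phi ->
  (forall r, 0 <= phi r) -> (forall r w, 0 <= w -> phi (r * w) = phi r * w) ->
  (\int[Pi]_z (phi (err_score z))%:E = \int[Pi]_z (phi (k z))%:E)%E.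
Proof.
move=> mphi phi0 phiM.
have mphif (f : Z -> R) : measurable_fun setT f ->
    measurable_fun setT (fun z => (phi (f z))%:E).
  by move=> mf; apply/measurable_EFinP; exact: measurableT_comp.
have phif0 (f : Z -> R) z : (0 <= (phi (f z))%:E)%E by rewrite lee_fin.
rewrite (fubini_tonelli1 _ (mphif _ merr) (phif0 _)).
rewrite (fubini_tonelli1 _ (mphif _ mk) (phif0 _)).
apply: eq_integral => x _; rewrite /fubini_F.
under eq_integral do rewrite -HT.
have mHx : measurable_fun setT
    ((fun S : borel_mx R m n => (phi (H x S))%:E) : borel_mx R m n -> \bar R).
  apply/measurable_EFinP; apply: (measurableT_comp mphi).
  exact: (measurableT_comp mH (pair1_measurable x)).
rewrite (gaussian_rank1_change v0 nuN (uT (x i ord0)) mHx).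
  apply: eq_integral => S _; rewrite -ratio_cv -EFinM; congr EFin.
  by apply/esym/phiM; exact: expR_ge0.
by move=> S; rewrite lee_fin.
Qed.

Let integral_ratio t : (\int[nu]_S (ratio t S)%:E = 1)%E.
Proof.
under eq_integral do rewrite ratio_cv -[(expR _)%:E]mul1e.
rewrite -(gaussian_rank1_change v0 nuN (uT t) (measurable_cst _))//.
by rewrite integral_cst//= probability_setT mule1.
Qed.

Let U (w : Z * measurableTypeR R) : Z := (set_entry i ord0 w.2 w.1.1, w.1.2).

Let mU : measurable_fun setT U.
Proof.
apply: measurable_fun_pair; last first.
  exact: measurableT_comp measurable_snd measurable_fst.
apply: measurable_set_entry; last exact: measurable_snd.
exact: measurableT_comp measurable_fst measurable_fst.
Qed.

Let PiU (f : Z -> \bar R) : measurable_fun setT f -> (forall z, 0 <= f z)%E ->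
  (\int[Pi]_z f z = \int[Pi]_z \int[q]_t f (U (z, t)))%E.
Proof.
move=> mf f0.
rewrite fubini_tonelli2// fubini_tonelli2//=; last 2 first.
- apply: (@measurable_fun_fubini_tonelli_F _ _ Z (measurableTypeR R) R q (f \o U)) => [|z].
    exact: measurableT_comp.
  exact: f0.
- by move=> z; exact: integral_ge0.
apply: eq_integral => S _; rewrite /fubini_G (iid_law_resample i ord0 muq)//.
exact: (measurableT_comp mf (pair2_measurable S)).
Qed.

(** For fixed [x], the integrand is the composite of the function [H], in which the
estimate is computed with [x_i] replaced by [0], and of the shear with parameter
[t = x_i]; removing the shear costs the density [ratio]. Then [x_i] is redrawn from the prior and
integrated by parts, which leaves [c] times the integral of [ratio]; this is
the integral of a probability density. *)
Lemma integral_err_score :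
  Pi.-integrable setT (fun z => ((estimate z.1 z.2 i ord0 - z.1 i ord0) *
    score z.1 z.2 i)%:E) ->
  (\int[Pi]_z ((estimate z.1 z.2 i ord0 - z.1 i ord0) * score z.1 z.2 i)%:E =
   c%:E)%E.
Proof.
move=> ierr.
have ik : Pi.-integrable setT (fun z => (k z)%:E).
  apply/integrableP; split; first exact/measurable_EFinP.
  rewrite -(shear_transfer (phi := fun r => `|r|))//; last first.
    by move=> r w w0; rewrite normrM (ger0_norm w0).
  by have /integrableP[] := ierr.
transitivity (\int[Pi]_z (k z)%:E)%E.
  rewrite -/(\int[Pi]_z (err_score z)%:E)%E integralE [RHS]integralE; congr (_ - _)%E.
    have pos (f : Z -> R) : (\int[Pi]_z (fun z => (f z)%:E)^\+ z =
        \int[Pi]_z (Num.max (f z) 0)%:E)%E.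
      by apply: eq_integral => z _; rewrite funeposE EFin_max.
    rewrite !pos; apply: (shear_transfer (phi := fun r => Num.max r 0)) => //.
    - exact: measurable_maxr.
    - by move=> r; rewrite le_max lexx orbT.
    - by move=> r w w0; rewrite maxr_pMl// mul0r.
  have neg (f : Z -> R) : (\int[Pi]_z (fun z => (f z)%:E)^\- z =
      \int[Pi]_z (Num.max (- f z) 0)%:E)%E.
    by apply: eq_integral => z _; rewrite funenegE EFin_max EFinN.
  rewrite !neg; apply: (shear_transfer (phi := fun r => Num.max (- r) 0)) => //.
  - by apply: measurable_maxr => //; exact: oppr_measurable.
  - by move=> r; rewrite le_max lexx orbT.
  - by move=> r w w0; rewrite maxr_pMl// mul0r mulNr.
rewrite (resampling_integrable mU PiU ik).
transitivity (\int[Pi]_z (c%:E * \int[q]_t (ratio t z.2)%:E))%E.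
  apply: eq_integral => -[x S] _ /=.
  rewrite -(prior_parts B0 qE (V S) (E S) (base x S) c0).
  apply: eq_integral => t _; by rewrite /k /H /U/= /base set_entryK set_entry_eq mulrA.
have mr : measurable_fun setT (fun z : Z => (ratio (z.1 i ord0) z.2)%:E).
  by apply/measurable_EFinP; exact: mratio.
have r0 (z : Z) : (0 <= (ratio (z.1 i ord0) z.2)%:E)%E by rewrite lee_fin expR_ge0.
have rE (z : Z) : (\int[q]_t (ratio t z.2)%:E =
    \int[q]_t (ratio ((U (z, t)).1 i ord0) (U (z, t)).2)%:E)%E.
  by apply: eq_integral => t _; rewrite /U/= set_entry_eq.
under eq_integral do rewrite rE.
rewrite ge0_integralZl//; last 3 first.
- have mrU := measurableT_comp mr mU.
  exact: (measurable_fun_fubini_tonelli_F _ mrU (fun z => r0 (U z))).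
- by move=> z _; apply: integral_ge0 => t _; exact: r0.
- by rewrite lee_fin ltW.
rewrite -(PiU mr r0) (fubini_tonelli1 _ mr r0).
under eq_integral do rewrite /fubini_F integral_ratio.
by rewrite integral_cst//= probability_setT !mule1.
Qed.

End coordinate.
End posterior_score.

(** * Second moments of the score *)

Section square_integrable.
Context {R : realType} d (T : measurableType d).
Variable P : probability T R.

Definition square_integrable (f : T -> R) : Prop :=
  measurable_fun setT f /\ (\int[P]_x (f x ^+ 2)%:E < +oo)%E.

Lemma square_integrable_integrable f : square_integrable f ->
  P.-integrable setT (fun x => (f x ^+ 2)%:E).
Proof.
move=> [mf fi]; apply/integrableP; split.
  exact/measurable_EFinP/measurable_funX.
by under eq_integral do rewrite /= ger0_norm ?sqr_ge0//.
Qed.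

Lemma square_integrableM f g : square_integrable f -> square_integrable g ->
  P.-integrable setT (fun x => (f x * g x)%:E).
Proof.
move=> Lf Lg; apply: (le_integrable measurableT _ _ (integrableD measurableT
  (square_integrable_integrable Lf) (square_integrable_integrable Lg))).
  by case: Lf Lg => mf _ [mg _]; apply/measurable_EFinP/measurable_funM.
move=> x _; rewrite /= lee_fin [leRHS]ger0_norm ?addr_ge0 ?sqr_ge0//.
move: (f x) (g x) => a b; rewrite ler_norml; apply/andP; split; nra.
Qed.

Lemma square_integrable_cst c : square_integrable (fun=> c).
Proof. by split => //; rewrite integral_cst//= probability_setT mule1 ltry. Qed.

Lemma square_integrable1 f : square_integrable f ->
  P.-integrable setT (fun x => (f x)%:E).
Proof.
move=> /square_integrableM /(_ (square_integrable_cst 1)).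
by under eq_fun do rewrite mulr1.
Qed.

End square_integrable.

Section score_moments.
Context {R : realType} {n d m : nat}.
Variables (A : 'M[R]_(n, d)) (y : 'cV[R]_n) (v B : R).
Hypotheses (v0 : 0 < v) (vm : v * m%:R = 1) (B0 : 0 < B) (Ay : A^T *m y = 0).
Variables (q : probability (measurableTypeR R) R)
  (mu : probability (borel_mx R d 1) R) (nu : probability (borel_mx R m n) R).
Hypotheses (qE : prior_law B q) (muq : iid_law q mu)
  (nuN : iid_law (normal_prob 0 (Num.sqrt v)) nu).
Local Notation Pi := (mu \x nu)%E.
Local Notation Z := (borel_mx R d 1 * borel_mx R m n)%type.
Local Notation c := (dot y y * v).
Local Notation kappa := ((pi / B) ^+ 2).
Local Notation G := (A^T *m A).

Let alpha (i : 'I_d) (S : 'M[R]_(m, n)) := dot (S *m col i A) (S *m y).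
Let s (i : 'I_d) (x : 'cV[R]_d) := prior_score B (x i ord0).

Let malpha i : measurable_fun setT (alpha i : borel_mx R m n -> R).
Proof.
by apply: measurable_dot; apply: measurable_mulmx => //; exact: measurable_cst.
Qed.

Let ms i : measurable_fun setT (s i : borel_mx R d 1 -> R).
Proof.
exact: measurableT_comp (@measurable_prior_score _ B) (measurable_coord i ord0).
Qed.

Let alpha_moment i j : (\int[nu]_S (alpha i S * alpha j S)%:E = (c * G i j)%:E)%E.
Proof.
have ay k : dot (col k A) y = 0 by rewrite colE dot_mulmxl Ay dot0r.
rewrite (covariance_dot v0 nuN (ay i) (ay j)); congr EFin.
have -> : G i j = dot (col i A) (col j A).
  by rewrite mxE; apply: eq_bigr => k _; rewrite !mxE.
by rewrite expr2 -(mulrA v) vm mulr1; ring.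
Qed.

Let alpha_sq i : square_integrable nu (alpha i : borel_mx R m n -> R).
Proof.
split; first exact: malpha.
by under eq_integral do rewrite expr2; rewrite alpha_moment ltry.
Qed.

Let q_sq : square_integrable q (prior_score B).
Proof.
by split; [exact: measurable_prior_score|rewrite integral_prior_score2// ltry].
Qed.

Let s_sq2 i : (\int[mu]_x (s i x ^+ 2)%:E = kappa%:E)%E.
Proof.
rewrite (iid_law_resample i ord0 muq).
- under eq_integral do under eq_integral do rewrite /s set_entry_eq.
  under eq_integral do rewrite integral_prior_score2//.
  by rewrite integral_cst//= probability_setT mule1.
- by apply/measurable_EFinP; exact: measurable_funX.
- by move=> x; rewrite lee_fin sqr_ge0.
Qed.

Let s_sq i : square_integrable mu (s i : borel_mx R d 1 -> R).
Proof. by split; [exact: ms|rewrite s_sq2 ltry]. Qed.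

Let s_mean i : (\int[mu]_x (s i x)%:E = 0)%E.
Proof.
rewrite (@iid_law_resample_integrable _ _ _ _ _ i ord0 _ muq (square_integrable1 (s_sq i))).
under eq_integral do under eq_integral do rewrite /s set_entry_eq.
under eq_integral do rewrite integral_prior_score//.
by rewrite integral0.
Qed.

Let s_moment i j : (\int[mu]_x (s i x * s j x)%:E = ((i == j)%:R * kappa)%:E)%E.
Proof.
have [<-|ij] := eqVneq i j.
  by under eq_integral do rewrite -expr2; rewrite s_sq2 mul1r.
rewrite (@iid_law_resample_integrable _ _ _ _ _ i ord0 _ muq
  (square_integrableM (s_sq i) (s_sq j))).
rewrite mul0r; under eq_integral => x _.
  under eq_integral => t _.
    rewrite /s set_entry_eq mxE eq_sym (negbTE ij)/= EFinM.
    over.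
  rewrite integralZr//=; last exact: square_integrable1 q_sq.
  rewrite integral_prior_score// mul0e.
  over.
by rewrite integral0.
Qed.

Let alpha_sqPi i : square_integrable Pi (fun z : Z => alpha i z.2).
Proof.
have ma : measurable_fun setT (fun z : Z => alpha i z.2).
  exact: measurableT_comp (malpha i) measurable_snd.
split => //; rewrite fubini_tonelli1/=.
- have [_ h] := alpha_sq i.
  by rewrite /fubini_F/= integral_cst//= probability_setT mule1.
- by apply/measurable_EFinP; exact: measurable_funX.
- by move=> z; rewrite lee_fin sqr_ge0.
Qed.

Let s_sqPi i : square_integrable Pi (fun z : Z => s i z.1).
Proof.
have ma : measurable_fun setT (fun z : Z => s i z.1).
  exact: measurableT_comp (ms i) measurable_fst.
split => //; rewrite fubini_tonelli1/=.
- have [_ h] := s_sq i; rewrite /fubini_F/=.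
  by under eq_integral do rewrite integral_cst//= probability_setT mule1.
- by apply/measurable_EFinP; exact: measurable_funX.
- by move=> z; rewrite lee_fin sqr_ge0.
Qed.

Let mixed i j : (\int[Pi]_z (alpha i z.2 * s j z.1)%:E = 0)%E.
Proof.
rewrite -integral21_prod_meas1; last exact: square_integrableM.
rewrite /fubini_G (eq_integral (cst 0%E)) ?integral0// => S _ /=.
transitivity (\int[mu]_x ((alpha i S)%:E * (s j x)%:E))%E.
  by apply: eq_integral => x _; rewrite EFinM.
by rewrite integralZl//= ?s_mean ?mule0//; exact: square_integrable1.
Qed.

Let scoreM i j z : (score A y v B z.1 z.2 i * score A y v B z.1 z.2 j)%:E =
  ((alpha i z.2 * alpha j z.2)%:E + (c%:E * (alpha i z.2 * s j z.1)%:E +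
   (c%:E * (alpha j z.2 * s i z.1)%:E +
    (c ^+ 2)%:E * (s i z.1 * s j z.1)%:E)))%E.
Proof.
by rewrite -!EFinM -!EFinD; congr EFin; rewrite /score /alpha /s; ring.
Qed.

Let integrable_terms i j :
  [/\ Pi.-integrable setT (fun z : Z => (alpha i z.2 * alpha j z.2)%:E),
   Pi.-integrable setT (fun z : Z => c%:E * (alpha i z.2 * s j z.1)%:E)%E,
   Pi.-integrable setT (fun z : Z => c%:E * (alpha j z.2 * s i z.1)%:E)%E &
   Pi.-integrable setT (fun z : Z => (c ^+ 2)%:E * (s i z.1 * s j z.1)%:E)%E].
Proof.
by split; [|apply: integrableZl => //..]; exact: square_integrableM.
Qed.

(** The two terms of the score are independent and the prior term is centred, so
the cross terms vanish. The first term has covariance [v^2 m |y|^2 G_ij], which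
is [c G_ij] because [v m = 1], and the coordinates of [x] are independent. *)
Lemma score_moment i j :
  (\int[Pi]_z (score A y v B z.1 z.2 i * score A y v B z.1 z.2 j)%:E =
   (c * G i j + (i == j)%:R * (c ^+ 2 * kappa))%:E)%E.
Proof.
have [i1 i2 i3 i4] := integrable_terms i j.
under eq_integral do rewrite scoreM.
rewrite integralD//; last by do 2 apply: integrableD => //.
rewrite integralD//; last exact: integrableD.
rewrite integralD// !integralZl//; [|exact: square_integrableM..].
rewrite !mixed !mule0 !add0e EFinD; congr (_ + _)%E.
  rewrite -integral21_prod_meas1// /fubini_G/= -alpha_moment.
  by apply: eq_integral => S _; rewrite integral_cst//= probability_setT mule1.
rewrite -integral12_prod_meas1; last exact: square_integrableM.
rewrite /fubini_F/=.
under eq_integral do rewrite integral_cst//= probability_setT mule1.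
by rewrite s_moment -EFinM; congr EFin; ring.
Qed.

Lemma score_square_integrable i :
  square_integrable Pi (fun z : Z => score A y v B z.1 z.2 i).
Proof.
split.
  apply: measurable_funD; first by have [] := alpha_sqPi i.
  by apply: measurable_funM; [exact: measurable_cst|have [] := s_sqPi i].
by under eq_integral do rewrite expr2; rewrite score_moment ltry.
Qed.

End score_moments.

(** * Bayes risk under the squared-cosine prior *)

Section bayes_risk.
Context {R : realType} {n d m : nat}.
Variables (A : 'M[R]_(n, d)) (y : 'cV[R]_n) (v B : R).
Hypotheses (d0 : (0 < d)%N) (rA : \rank A = d).
Hypotheses (v0 : 0 < v) (vm : v * m%:R = 1) (B0 : 0 < B).
Hypotheses (y0 : 0 < dot y y) (Ay : A^T *m y = 0).
Variable nu : probability (borel_mx R m n) R.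
Hypothesis nuN : iid_law (normal_prob 0 (Num.sqrt v)) nu.
Variable g : 'M[R]_(m, d) * 'cV[R]_m -> 'cV[R]_d.
Hypothesis mg : measurable_estimator g.
Local Notation c := (dot y y * v).
Local Notation kappa := ((pi / B) ^+ 2).
Local Notation G := (A^T *m A).
Local Notation Z := (borel_mx R d 1 * borel_mx R m n)%type.

Definition loss (x : 'cV[R]_d) (S : 'M[R]_(m, n)) : R :=
  dot (A *m (estimate A y g x S - x)) (A *m (estimate A y g x S - x)).

Let measurable_err : measurable_fun setT
  ((fun z => estimate A y g z.1 z.2 - z.1) : Z -> borel_mx R d 1).
Proof.
apply: measurable_addmx.
  apply: measurable_estimator_comp => //.
    by apply: measurable_mulmx => //; exact: measurable_cst.
  apply: measurable_mulmx => //; apply: measurable_addmx; last exact: measurable_cst.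
  by apply: measurable_mulmx => //; exact: measurable_cst.
apply: measurable_mxP => i j; under eq_fun do rewrite mxE.
apply: (measurableT_comp (@oppr_measurable R setT)).
exact: measurableT_comp (measurable_coord i j) measurable_fst.
Qed.

Lemma measurable_loss : measurable_fun setT (fun z : Z => loss z.1 z.2).
Proof.
by apply: measurable_dot; apply: measurable_mulmx => //; exact: measurable_cst.
Qed.

(** The difference of the two sides is [|A (e - G^-1 psi)|^2], with [e] the
estimation error. *)
Lemma loss_lower_bound x S (psi : 'cV[R]_d) :
  \sum_i 2 * ((estimate A y g x S i ord0 - x i ord0) * psi i ord0) -
  \sum_i \sum_j invmx G i j * (psi i ord0 * psi j ord0) <= loss x S.
Proof.
pose e := estimate A y g x S - x.
have -> : \sum_i 2 * ((estimate A y g x S i ord0 - x i ord0) * psi i ord0) =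
    2 * dot e psi.
  by rewrite -mulr_sumr; congr (_ * _); apply: eq_bigr => i _; rewrite !mxE.
have -> : \sum_i \sum_j invmx G i j * (psi i ord0 * psi j ord0) =
    dot psi (invmx G *m psi).
  apply: eq_bigr => i _; rewrite mxE mulr_sumr; apply: eq_bigr => j _; ring.
have h (u : 'cV[R]_d) : 2 * dot u psi - dot psi (invmx G *m psi) <=
    dot (A *m u) (A *m u).
  have cross : dot (A *m u) (A *m (invmx G *m psi)) = dot u psi.
    by rewrite dot_mulmxl !mulmxA mulmxV ?gram_unit// mul1mx.
  rewrite -subr_ge0.
  rewrite (_ : _ - _ = dot (A *m (u - invmx G *m psi)) (A *m (u - invmx G *m psi))).
    exact: dotxx_ge0.
  rewrite mulmxBr !(dotDl, dotDr, dotNl, dotNr) dot_inv_gram// cross.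
  by rewrite [dot (A *m (invmx G *m psi)) _]dotC cross; ring.
exact: h.
Qed.

Variable M : R.
Hypothesis risk_bound : forall x : 'cV[R]_d, (forall i, - B <= x i ord0 <= B) ->
  (\int[nu]_S (loss x S)%:E <= M%:E)%E.

(** A uniform bound on the risk over the cube makes the errors square integrable
for the joint law, so that the pointwise bound [loss_lower_bound] at the score
can be integrated term by term. *)
Lemma bayes_risk_bound :
  d%:R * c * (1 - c * kappa / min_eigenvalue G) <= M.
Proof.
have [q qE] := prior_exists B0.
have [mu muq] := @iid_law_exists R d 1 q.
pose Pi := (mu \x nu)%E.
have loss0 (z : Z) : (0 <= (loss z.1 z.2)%:E)%E by rewrite lee_fin dotxx_ge0.
have mloss : measurable_fun setT (fun z : Z => (loss z.1 z.2)%:E).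
  by apply/measurable_EFinP; exact: measurable_loss.
have lossM : (\int[Pi]_z (loss z.1 z.2)%:E <= M%:E)%E.
  rewrite (fubini_tonelli1 _ mloss loss0).
  apply: (@le_trans _ _ (\int[mu]_x M%:E)%E); last first.
    by rewrite integral_cst//= probability_setT mule1.
  have M0 : 0 <= M.
    rewrite -lee_fin; apply: (@le_trans _ _ (\int[nu]_S (loss 0 S)%:E)%E).
      by apply: integral_ge0 => S _; exact: (loss0 (0, S)).
    by apply: risk_bound => i; rewrite mxE oppr_le0 ltW.
  (* The risk is only bounded on the cube, which carries the prior. *)
  apply: ae_ge0_le_integral => //.
  - by move=> x _; apply: integral_ge0 => S _; exact: (loss0 (x, S)).
  - exact: measurable_fun_fubini_tonelli_F.
  - exists (~` box (fun _ _ => `]- B, B[%classic)); split.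
    + by apply: measurableC; exact: measurable_box.
    + have mb := @measurable_box R d 1 (fun _ _ => `]- B, B[%classic)
        (fun _ _ => measurable_itv _).
      apply: (etrans (probability_setC mu mb)).
      rewrite muq// big1 ?subee// => ij _; exact: prior_support.
    + move=> x /=; apply: contra_not => xB _; apply: risk_bound => i.
      by have := xB i ord0; rewrite /= in_itv/= => /andP[/ltW -> /ltW ->].
have [l0 lP] := min_eigenvalue_gram d0 rA.
have iloss : Pi.-integrable setT (fun z : Z => (loss z.1 z.2)%:E).
  apply/integrableP; split => //.
  under eq_integral do rewrite gee0_abs//.
  by rewrite (le_lt_trans lossM)// ltry.
pose err i (z : Z) := estimate A y g z.1 z.2 i ord0 - z.1 i ord0.
(* An error coordinate is controlled by the loss through the least eigenvalue. *)
have err_sq i : square_integrable Pi (err i).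
  have merr : measurable_fun setT (err i).
    have := measurableT_comp (measurable_coord i ord0) measurable_err.
    by apply: eq_measurable_fun => z _ /=; rewrite !mxE.
  split => //.
  apply: (@le_lt_trans _ _ (\int[Pi]_z ((min_eigenvalue G)^-1%:E * (loss z.1 z.2)%:E))%E).
    apply: ge0_le_integral => //.
    - by move=> z _; rewrite lee_fin sqr_ge0.
    - exact/measurable_EFinP/measurable_funX.
    - by apply: emeasurable_funM.
    - move=> z _; rewrite -EFinM lee_fin -ler_pdivrMl ?invr_gt0// invrK.
      apply: le_trans (lP _); rewrite ler_pM2l//.
      by have := dot_coord_le (estimate A y g z.1 z.2 - z.1) i; rewrite !mxE.
  rewrite integralZl// lte_mul_pinfty// ?lee_fin ?invr_ge0 ?ltW//.
  by rewrite (le_lt_trans lossM)// ltry.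
pose psi i (z : Z) := score A y v B z.1 z.2 i.
have psi_sq i : square_integrable Pi (psi i).
  exact: (score_square_integrable v0 vm B0 Ay qE muq nuN).
have ierr i : Pi.-integrable setT (fun z => (err i z * psi i z)%:E).
  exact: square_integrableM.
have Eerr i : (\int[Pi]_z (err i z * psi i z)%:E = c%:E)%E.
  exact: (integral_err_score v0 B0 y0 Ay qE muq nuN mg (ierr i)).
have ipsi i j : Pi.-integrable setT (fun z => (psi i z * psi j z)%:E).
  exact: square_integrableM.
have Epsi i j : (\int[Pi]_z (psi i z * psi j z)%:E =
    (c * G i j + (i == j)%:R * (c ^+ 2 * kappa))%:E)%E.
  exact: (score_moment v0 vm B0 Ay qE muq nuN).
pose low (z : Z) : \bar R := ((\sum_i 2%:E * (err i z * psi i z)%:E) -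
  \sum_i \sum_j ((invmx G i j)%:E * (psi i z * psi j z)%:E))%E.
have ierr2 i : Pi.-integrable setT (fun z => 2%:E * (err i z * psi i z)%:E)%E.
  exact: integrableZl (ierr i).
have ipsi2 i j : Pi.-integrable setT
    (fun z => (invmx G i j)%:E * (psi i z * psi j z)%:E)%E.
  exact: integrableZl (ipsi i j).
have i1 : Pi.-integrable setT (fun z => \sum_i 2%:E * (err i z * psi i z)%:E)%E.
  by apply: integrable_sum => // i; exact: ierr2.
have i2 : Pi.-integrable setT
    (fun z => \sum_i \sum_j ((invmx G i j)%:E * (psi i z * psi j z)%:E))%E.
  by apply: integrable_sum => // i _; apply: integrable_sum => // j _; exact: ipsi2.
have ilow : Pi.-integrable setT low by exact: integrableB.
have lowE : (\int[Pi]_z low z = (d%:R * c - c ^+ 2 * kappa * \tr (invmx G))%:E)%E.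
  have E1 : (\int[Pi]_z (\sum_i 2%:E * (err i z * psi i z)%:E) =
      (\sum_(i < d) 2 * c)%:E)%E.
    rewrite integral_sum//; rewrite -sumEFin; apply: eq_bigr => i _.
    by rewrite integralZl// Eerr.
  have E2 : (\int[Pi]_z (\sum_i \sum_j ((invmx G i j)%:E * (psi i z * psi j z)%:E)) =
      (\sum_i \sum_j invmx G i j * (c * G i j + (i == j)%:R * (c ^+ 2 * kappa)))%:E)%E.
    rewrite integral_sum//; last first.
      by move=> i; apply: integrable_sum => // j _; exact: ipsi2.
    rewrite -sumEFin; apply: eq_bigr => i _.
    rewrite integral_sum// -sumEFin; apply: eq_bigr => j _.
    by rewrite integralZl// Epsi.
  rewrite integralB// E1 E2 -EFinB; congr EFin.
  rewrite sumr_const card_ord.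
  (* The trace of G^-1 G contributes c per coordinate, one half of the linear term. *)
  have E3 i : \sum_j invmx G i j * (c * G i j + (i == j)%:R * (c ^+ 2 * kappa)) =
      c + invmx G i i * (c ^+ 2 * kappa).
    under eq_bigr do rewrite mulrDr.
    rewrite big_split/=; congr (_ + _).
      have QG : \sum_j invmx G i j * G j i = 1.
        have /matrixP/(_ i i) := mulVmx (gram_unit rA).
        by rewrite [LHS]mxE [RHS]mxE eqxx.
      rewrite -[RHS]mulr1 -[X in _ = _ * X]QG mulr_sumr; apply: eq_bigr => j _.
      have /matrixP/(_ j i) := gram_sym A.
      by rewrite [LHS]mxE mulrCA => ->.
    rewrite (bigD1 i)//= eqxx mul1r big1 ?addr0// => j ji.
    by rewrite eq_sym (negbTE ji) mul0r mulr0.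
  under eq_bigr do rewrite E3.
  rewrite big_split/= sumr_const card_ord -mulr_suml -/(\tr (invmx G)).
  by rewrite -[(2 * c) *+ d]mulr_natl -[c *+ d]mulr_natl; ring.
have : (\int[Pi]_z low z <= M%:E)%E.
  apply: le_trans lossM; apply: le_integral => // z _.
  have := loss_lower_bound z.1 z.2 (\col_i psi i z).
  rewrite -lee_fin; congr (_ <= _)%E; rewrite /low EFinB -!sumEFin; congr (_ - _)%E.
    by apply: eq_bigr => i _; rewrite mxE EFinM.
  apply: eq_bigr => i _; rewrite -sumEFin; apply: eq_bigr => j _.
  by rewrite !mxE EFinM.
rewrite lowE lee_fin; apply: le_trans.
rewrite (_ : d%:R * c * _ = d%:R * c - c ^+ 2 * kappa * (d%:R / min_eigenvalue G)); last first.
  by field; rewrite !gt_eqF.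
rewrite lerD2l lerN2 ler_wpM2l//.
  by rewrite mulr_ge0 ?sqr_ge0.
rewrite /mxtrace mulr_natl -[X in _ *+ X]card_ord -sumr_const.
by apply: ler_sum => i _; exact: inv_gram_diag.
Qed.

End bayes_risk.

(** * From the Bayes risk to the minimax bound *)

Lemma l2norm_sqr (R : realType) n (x : 'cV[R]_n) : l2norm x ^+ 2 = dot x x.
Proof.
rewrite /l2norm sqr_sqrtr; last by apply: sumr_ge0 => i _; rewrite sqr_ge0.
by apply: eq_bigr => i _; rewrite expr2.
Qed.

Section gaussian_sketch.
Context {R : realType} disp (Omega : measurableType disp) (P : probability Omega R).
Context {m n : nat} (S : 'I_m -> 'I_n -> {RV P >-> R}).

Lemma measurable_random_matrix :
  measurable_fun setT (random_matrix S : Omega -> borel_mx R m n).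
Proof.
apply: measurable_mxP => i j; under eq_fun do rewrite mxE.
exact: measurable_funPT.
Qed.

Definition sketch_law : probability (borel_mx R m n) R :=
  distribution P (mfun_of measurable_random_matrix).

Lemma sketch_law_iid v : iid_gaussian S 0 v ->
  iid_law (normal_prob 0 (Num.sqrt v)) sketch_law.
Proof.
move=> [indep gauss] U mU.
have := indep [set: 'I_m * 'I_n]%SET (fun ij => U ij.1 ij.2) (fun ij => mU _ _).
rewrite (_ : \bigcap_(_ in _) _ = random_matrix S @^-1` box U); last first.
  apply/seteqP; split => w /=.
    by move=> h i j; rewrite mxE; apply: (h (i, j)); rewrite /= inE.
  by move=> h [i j] _ /=; have := h i j; rewrite mxE.
move=> indepE; apply: (etrans indepE).
apply: eq_big => [ij|ij _]; first by rewrite inE.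
exact: (gauss ij.1 ij.2 _ (mU _ _)).
Qed.

Lemma expectation_sketch (f : 'M[R]_(m, n) -> R) :
  measurable_fun setT (f : borel_mx R m n -> R) -> (forall M, 0 <= f M) ->
  ('E_P[fun w => f (random_matrix S w)] = \int[sketch_law]_M (f M)%:E)%E.
Proof.
move=> mf f0; rewrite unlock ge0_integral_distribution//.
exact/measurable_EFinP.
Qed.

End gaussian_sketch.

Section least_squares_design.
Context {R : realType} {n d : nat}.
Variable A : 'M[R]_(n, d).
Hypothesis rA : \rank A = d.

(** The kernel of [A^T] is nonzero, as [A] has more rows than its rank. *)
Lemma orthogonal_residual (sigma : R) : (d < n)%N ->
  exists y : 'cV[R]_n, A^T *m y = 0 /\ dot y y = sigma ^+ 2.
Proof.
move=> dn; pose u := (nz_row (kermx A))^T.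
have uA : A^T *m u = 0.
  rewrite /u -trmx_mul; apply/trmx_inj; rewrite trmxK trmx0.
  by apply/sub_kermxP; exact: nz_row_sub.
have u0 : 0 < dot u u.
  rewrite lt_def dotxx_ge0 andbT; apply/eqP => /dotxx_eq0/(congr1 trmx).
  rewrite trmxK trmx0 => /eqP; rewrite nz_row_eq0 -mxrank_eq0 mxrank_ker rA.
  by rewrite subn_eq0 leqNgt dn.
exists ((sigma / Num.sqrt (dot u u)) *: u); split.
  by rewrite -scalemxAr uA scaler0.
rewrite dotZl dotZr mulrA -expr2 expr_div_n sqr_sqrtr ?ltW// divfK//.
by rewrite gt_eqF.
Qed.

(** Pythagoras: the objective at [z] is [|A (z - x)|^2 + |y|^2]. *)
Lemma least_squares_orthogonal (C : set 'cV[R]_d) (x : 'cV[R]_d) (y : 'cV[R]_n) :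
  C x -> A^T *m y = 0 -> least_squares A C (A *m x + y) = [set x].
Proof.
move=> Cx Ay.
have E z : l2norm (A *m z - (A *m x + y)) ^+ 2 =
    dot (A *m (z - x)) (A *m (z - x)) + dot y y.
  rewrite l2norm_sqr (_ : _ - _ = A *m (z - x) - y); last first.
    by rewrite mulmxBr opprD addrA.
  rewrite !(dotDl, dotDr, dotNl, dotNr) [dot y (A *m _)]dotC.
  by rewrite [dot (A *m _) y]dot_mulmxl Ay dot0r; ring.
apply/seteqP; split => [z [Cz zmin]|_ ->] /=.
  have := zmin x Cx; rewrite !E subrr mulmx0 lerD2r dot0l => le0.
  apply/eqP; rewrite -subr_eq0; apply/eqP.
  apply: (full_rank_inj rA); apply: dotxx_eq0; apply/eqP.
  by rewrite eq_le le0 dotxx_ge0.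
split => // z Cz; rewrite !E subrr mulmx0 lerD2r dot0l.
exact: dotxx_ge0.
Qed.

Lemma x_LS_orthogonal (C : set 'cV[R]_d) (x : 'cV[R]_d) (y : 'cV[R]_n) :
  C x -> A^T *m y = 0 -> x_LS A C (A *m x + y) = x.
Proof.
move=> Cx Ay; rewrite /x_LS least_squares_orthogonal//.
by apply: xget_unique => // z ->.
Qed.

Lemma Y_orthogonal (C : set 'cV[R]_d) (x : 'cV[R]_d) (y : 'cV[R]_n) sigma :
  C x -> A^T *m y = 0 -> 0 <= sigma -> dot y y = sigma ^+ 2 ->
  Y_ A C sigma (A *m x + y).
Proof.
move=> Cx Ay s0 ys; split.
  by rewrite least_squares_orthogonal//; exists x.
rewrite x_LS_orthogonal// addrC addKr.
apply/eqP; rewrite -(@eqrXn2 _ 2)// ?l2norm_sqr ?ys//.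
by rewrite /l2norm sqrtr_ge0.
Qed.

End least_squares_design.

Section minimax.
Context {R : realType} {n d m : nat}.
Variables (A : 'M[R]_(n, d)) (disp : measure_display) (Omega : measurableType disp)
  (P : probability Omega R) (S : 'I_m -> 'I_n -> {RV P >-> R}).
Hypotheses (d0 : (0 < d)%N) (dn : (d < n)%N) (m0 : (0 < m)%N) (rA : \rank A = d).
Hypothesis Sgauss : iid_gaussian S 0 (m%:R^-1).
Variable g : 'M[R]_(m, d) * 'cV[R]_m -> 'cV[R]_d.
Hypothesis mg : measurable_estimator g.

Definition risk (C : set 'cV[R]_d) (y : 'cV[R]_n) : \bar R :=
  'E_P[fun w => (l2norm (A *m (g (random_matrix S w *m A,
    random_matrix S w *m y) - x_LS A C y)) ^+ 2)%R].

Lemma risk_orthogonal (C : set 'cV[R]_d) x (y : 'cV[R]_n) :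
  C x -> A^T *m y = 0 ->
  (risk C (A *m x + y) = \int[sketch_law S]_M (loss A y g x M)%:E)%E.
Proof.
move=> Cx Ay; rewrite /risk x_LS_orthogonal//.
rewrite -(@expectation_sketch _ _ _ _ _ _ S (loss A y g x)).
- congr expectation; apply/funext => w; rewrite l2norm_sqr//.
- exact: (measurableT_comp (measurable_loss A y mg)
    (@pair1_measurable _ _ (borel_mx R d 1) (borel_mx R m n) x)).
- by move=> M; exact: dotxx_ge0.
Qed.

(** When the supremum is a real number [M], it bounds the risk on the whole cube
and [bayes_risk_bound] applies. For [sigma = 0] the score vanishes identically,
but there the claim is that the supremum is nonnegative. *)
Lemma minimax_lower_bound (C : set 'cV[R]_d) (B sigma : R) :
  0 < B -> [set x : 'cV[R]_d | forall i, - B <= x i ord0 <= B] `<=` C ->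
  0 <= sigma ->
  ((d%:R / m%:R * sigma ^+ 2 *
     (1 - pi ^+ 2 * sigma ^+ 2 /
          (m%:R * B ^+ 2 * min_eigenvalue (A^T *m A))))%:E
   <= ereal_sup [set risk C y | y in Y_ A C sigma])%E.
Proof.
move=> B0 BC s0; have [y [Ay ys]] := orthogonal_residual rA sigma dn.
have le_sup x : C x ->
    (\int[sketch_law S]_M (loss A y g x M)%:E <=
     ereal_sup [set risk C y | y in Y_ A C sigma])%E.
  move=> Cx; rewrite -(risk_orthogonal Cx Ay); apply: ereal_sup_ubound.
  by exists (A *m x + y) => //; exact: Y_orthogonal.
have sup0 : (0 <= ereal_sup [set risk C y | y in Y_ A C sigma])%E.
  apply: le_trans (le_sup 0 _).
    by apply: integral_ge0 => M _; rewrite lee_fin dotxx_ge0.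
  by apply: BC => i; rewrite mxE oppr_le0 ltW.
have [sz|sz] := eqVneq sigma 0.
  by move: sup0; rewrite sz expr0n/= mulr0 mul0r.
case: (ereal_sup _) le_sup sup0 => [M|//|//] le_sup _; last by rewrite leey.
have [l0 _] := min_eigenvalue_gram d0 rA.
have mR : 0 < m%:R :> R by rewrite ltr0n.
have v0 : 0 < m%:R^-1 :> R by rewrite invr_gt0.
have vm : m%:R^-1 * m%:R = 1 :> R by rewrite mulVf ?gt_eqF.
have y0 : 0 < dot y y by rewrite ys exprn_even_gt0.
have := @bayes_risk_bound R n d m A y m%:R^-1 B d0 rA v0 vm B0 y0 Ay
  (sketch_law S) (sketch_law_iid Sgauss) g mg M (fun x xB => le_sup x (BC x xB)).
rewrite lee_fin; congr (_ <= _); rewrite ys; field.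
by rewrite !gt_eqF.
Qed.

(** Every cube is contained in the whole space. If the supremum [M] were less than
the limit [K] of the bounds [K (1 - a / B^2)], the cube of half-width
[1 + K a / (K - M)] would give a contradiction. *)
Lemma minimax_lower_bound_unconstrained (sigma : R) : 0 <= sigma ->
  ((d%:R / m%:R * sigma ^+ 2)%:E
   <= ereal_sup [set risk setT y | y in Y_ A setT sigma])%E.
Proof.
move=> s0.
have lb B : 0 < B -> _ := fun B0 => @minimax_lower_bound setT B sigma B0 (@subsetT _ _) s0.
move: lb; case: (ereal_sup _) => [M|_|/(_ 1 ltr01)//]; last by rewrite leey.
set K := d%:R / m%:R * sigma ^+ 2 => lb.
have [l0 _] := min_eigenvalue_gram d0 rA.
have mR : 0 < m%:R :> R by rewrite ltr0n.
have K0 : 0 <= K by rewrite mulr_ge0 ?sqr_ge0// divr_ge0.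
pose a := pi ^+ 2 * sigma ^+ 2 / (m%:R * min_eigenvalue (A^T *m A)).
have a0 : 0 <= a.
  by apply: divr_ge0; apply: mulr_ge0; rewrite ?sqr_ge0 ?ler0n ?(ltW l0).
rewrite lee_fin leNgt; apply/negP => MK.
have e0 : 0 < K - M by rewrite subr_gt0.
pose B := 1 + K * a / (K - M).
have B1 : 1 <= B by rewrite /B lerDl divr_ge0 ?(ltW e0)// mulr_ge0.
have B0 : 0 < B by rewrite (lt_le_trans _ B1).
have := lb B B0; rewrite lee_fin => leM.
have : K * a / B < K - M.
  rewrite ltr_pdivrMr// (_ : (K - M) * B = (K - M) + K * a) ?ltrDr//.
  by rewrite /B; field; rewrite gt_eqF.
apply/negP; rewrite -leNgt.
apply: (@le_trans _ _ (K * a / B ^+ 2)).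
  move: leM; rewrite (_ : _ / (m%:R * B ^+ 2 * _) = a / B ^+ 2).
    by rewrite mulrBr mulr1 mulrA; lra.
  by rewrite /a; field; rewrite !gt_eqF.
apply: ler_wpM2l; first exact: mulr_ge0.
rewrite lef_pV2 ?posrE ?exprn_gt0//.
by rewrite expr2 ler_peMr// ltW.
Qed.

End minimax.

Theorem theorem5 (R : realType) (n d m : nat) (A : 'M[R]_(n, d))
    (disp : measure_display) (Omega : measurableType disp)
    (P : probability Omega R) (S : 'I_m -> 'I_n -> {RV P >-> R}) :
  (0 < d)%N -> (d < n)%N -> (0 < m)%N -> \rank A = d ->
  iid_gaussian S 0 (m%:R^-1) ->
  (forall (C : set 'cV[R]_d) (B : R),
     convex_set (C : set (convex_lmodType 'cV[R]_d)) ->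
     0 < B ->
     [set x : 'cV[R]_d | forall i, - B <= x i ord0 <= B] `<=` C ->
     forall g : 'M[R]_(m, d) * 'cV[R]_m -> 'cV[R]_d, measurable_estimator g ->
     forall sigma : R, 0 <= sigma ->
     ((d%:R / m%:R * sigma ^+ 2 *
        (1 - pi ^+ 2 * sigma ^+ 2 /
             (m%:R * B ^+ 2 * min_eigenvalue (A^T *m A))))%:E
      <= ereal_sup
           [set 'E_P[fun w =>
                  (l2norm (A *m (g (random_matrix S w *m A,
                                   random_matrix S w *m y)
                                - x_LS A C y)) ^+ 2)%R]
           | y in Y_ A C sigma])%E) /\
  (forall g : 'M[R]_(m, d) * 'cV[R]_m -> 'cV[R]_d, measurable_estimator g ->
     forall sigma : R, 0 <= sigma ->
     ((d%:R / m%:R * sigma ^+ 2)%:E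
      <= ereal_sup
           [set 'E_P[fun w =>
                  (l2norm (A *m (g (random_matrix S w *m A,
                                   random_matrix S w *m y)
                                - x_LS A [set: 'cV[R]_d] y)) ^+ 2)%R]
           | y in Y_ A [set: 'cV[R]_d] sigma])%E).
Proof.
move=> d0 dn m0 rA Sgauss; split.
  by move=> C B _ B0 BC g mg sigma s0; exact: minimax_lower_bound.
by move=> g mg sigma s0; exact: minimax_lower_bound_unconstrained.
Qed.
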